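(* Let $\lambda>1$ and let $A:\mathbb R^d\to\mathbb C^{\ell\times\ell}$ be a matrix-valued function with $A(\xi)=A(0)+O(\|\xi\|)$ as $\xi\to0$. Put $A^{(N)}(\xi)=A(\lambda^{-N+1}\xi)\cdots A(\lambda^{-1}\xi)A(\xi)$. Let $\chi_1>\dots>\chi_l$ be the distinct values of $\{\log|\mu| : \mu\in\operatorname{Spec}A(0)\setminus\{0\}\}$, $\chi_{l+1}=-\infty$, let $E_j:=\bigoplus\{E_\mu : \mu\in\operatorname{Spec}A(0),\ \log|\mu|=\chi_j\}$ where $E_\mu$ is the generalized eigenspace of $A(0)$ for $\mu$, let $m_j=\dim E_j$, and let $P_j$ ($j\in[l+1]$) be the projections associated to the decomposition $\mathbb C^\ell=\bigoplus_{j=1}^{l+1}E_j$, so $\operatorname{Im}P_j=E_j$ and $\sum_jP_j=I$. Then there exists $R>0$ such that for all $\xi\in B_R$ there exist projections (idempotent linear maps) $P_j(\xi)$ on $\mathbb C^\ell$, $j\in[l+1]$, with $\sum_{j=1}^{l+1}P_j(\xi)=I$, such that the following hold as $N\to\infty$, uniformly for $\xi\in B_R$, $x\in\mathbb C^\ell$: (i) for all $j\in[l+1]$: $\ \|A^{(N)}(\xi)P_j(\xi)x\|\approx e^{\chi_jN}\|P_j(\xi)x\|$; (ii) for all $j,k\in[l+1]$: $\ \|P_kA^{(N)}(\xi)P_j(\xi)x\|\lesssim\lambda^{-N}\|A^{(N)}(\xi)P_j(\xi)x\|$ if $j>k$, and $\ \|P_kA^{(N)}(\xi)P_j(\xi)x\|\lessapprox\max(e^{\chi_k-\chi_j},\lambda^{-1})^N\|A^{(N)}(\xi)P_j(\xi)x\|$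 if $j<k$; (iii) for all $j\in[l]$ with $m_j=1$: $\ \|A^{(N)}(\xi)P_j(\xi)x\|\gtrsim e^{\chi_jN}\|P_j(\xi)x\|$; (iv) if $A(0)$ is diagonalizable, then for all $j\in[l]$: $\ \|A^{(N)}(\xi)P_j(\xi)x\|\asymp e^{\chi_jN}\|P_j(\xi)x\|$.
   Context: $[n]=\{1,\dots,n\}$; $B_R$ is the closed ball of radius $R$ around $0$ in $\mathbb R^d$; $\|\cdot\|$ is any norm on $\mathbb C^\ell$; $\log0=-\infty$, $e^{-\infty}=0$. The projections are not assumed orthogonal. For $f,g:\mathbb N\times Y\to\mathbb R_{\ge0}$, as $N\to\infty$ uniformly for $y\in Y$: $f\lesssim g$ (equivalently $g\gtrsim f$) means there are $C>0$, $N_0\in\mathbb N$ with $f(N,y)\le Cg(N,y)$ for all $N\ge N_0$, $y\in Y$; $f\asymp g$ means $f\lesssim g$ and $g\lesssim f$. The relation $f\lessapprox g$ means inequality up to subexponential factors: for every $\epsilon>0$ there is $N_0$ with $f(N,y)\le e^{\epsilon N}g(N,y)$ for all $N\ge N_0$, $y\in Y$; $f\gtrapprox g$ means $g\lessapprox f$; $f\approx g$ means both. When $\chi_j=-\infty$, $f\lessapprox e^{\chi_jN}g$ means: for every $K>0$ there is $N_0$ with $f(N,y)\le e^{-KN}g(N,y)$ for all $N\ge N_0$, $y\in Y$ (and $f\gtrapprox e^{\chi_jN}g$ is void). *)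

(* Defs.v *)
From mathcomp Require Import all_boot all_order all_algebra complex.
From mathcomp Require Import all_classical all_reals all_analysis.

Set Implicit Arguments.
Unset Strict Implicit.
Unset Printing Implicit Defensive.

Import Order.TTheory GRing.Theory Num.Theory.
Import Normc.

Local Open Scope classical_set_scope.
Local Open Scope ring_scope.

Section Norms.
Variable R : realType.

(* The modulus of z : R[i] as an element of R (mathcomp's `|z| lies in R[i]). *)
Definition cabs (z : R[i]) : R := normc z.

Definition is_cnorm (ell : nat) (nrm : 'cV[R[i]]_ell -> R) : Prop :=
  [/\ forall x y, nrm (x + y) <= nrm x + nrm y,
      forall (a : R[i]) x, nrm (a *: x) = cabs a * nrm x
    & forall x, nrm x = 0 -> x = 0].

Definition enorm (d : nat) (xi : 'cV[R]_d) : R :=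
  Num.sqrt (\sum_(i < d) (xi i 0) ^+ 2).

Definition eball (d : nat) (r : R) : set 'cV[R]_d := [set xi | enorm xi <= r].

(* A(xi) = A(0) + O(|xi|) as xi -> 0, the remainder being measured in the
   max-norm on matrices. *)
Definition lipschitz_at0 (d ell : nat) (A : 'cV[R]_d -> 'M[R[i]]_ell) : Prop :=
  exists C delta : R, [/\ 0 < C, 0 < delta &
    forall xi, enorm xi <= delta ->
      forall i j, cabs (A xi i j - A 0 i j) <= C * enorm xi].

End Norms.

(* Asymptotic relations as N -> oo, uniformly for y in the set D. *)
Section Asymptotics.
Variables (R : realType) (Y : Type) (D : set Y).
Implicit Types f g : nat -> Y -> R.

Definition lesssim f g : Prop :=
  exists C : R, 0 < C /\ exists N0 : nat,
    forall N y, (N0 <= N)%N -> D y -> f N y <= C * g N y.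

Definition asymp f g : Prop := lesssim f g /\ lesssim g f.

Definition lessapprox f g : Prop :=
  forall eps : R, 0 < eps -> exists N0 : nat,
    forall N y, (N0 <= N)%N -> D y -> f N y <= expR (eps * N%:R) * g N y.

(* e^(chi N), with e^(-oo) = 0; only used for chi < +oo. *)
Definition exprate (chi : \bar R) (N : nat) : R :=
  fine (expeR (chi * N%:R%:E)%E).

(* f <~ e^(chi N) g up to subexponential factors. *)
Definition lessapprox_rate (chi : \bar R) f g : Prop :=
  if chi == -oo%E then
    forall K : R, 0 < K -> exists N0 : nat,
      forall N y, (N0 <= N)%N -> D y -> f N y <= expR (- K * N%:R) * g N y
  else lessapprox f (fun N y => exprate chi N * g N y).

Definition gtrapprox_rate (chi : \bar R) f g : Prop :=
  if chi == -oo%E then True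
  else lessapprox (fun N y => exprate chi N * g N y) f.

Definition approx_rate (chi : \bar R) f g : Prop :=
  lessapprox_rate chi f g /\ gtrapprox_rate chi f g.

End Asymptotics.

Section Spectral.
Variables (R : realType) (ell : nat).
Implicit Types M : 'M[R[i]]_ell.

Definition spectrum M : seq R[i] :=
  undup (sval (closed_field_poly_normal (char_poly M))).

Lemma mem_spectrum M mu : (mu \in spectrum M) = eigenvalue M mu.
Proof.
rewrite /spectrum mem_undup eigenvalue_root_char.
case: (closed_field_poly_normal _) => r /= ->.
by rewrite (monicP (char_poly_monic M)) scale1r root_prod_XsubC.
Qed.

(* log|mu|, with log 0 = -oo. *)
Definition logabs (mu : R[i]) : \bar R := lne (cabs mu)%:E.

(* [:: chi_1; ...; chi_l], in decreasing order. *)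
Definition exponents M : seq (\bar R) :=
  sort >=%O (undup [seq logabs mu | mu <- spectrum M & mu != 0]).

Definition nexp M : nat := size (exponents M).

(* Indices start at 0: chi M j is chi_(j+1), and chi M (nexp M) = -oo. *)
Definition chi M (j : nat) : \bar R := nth -oo%E (exponents M) j.

(* Matrices act on column vectors, on the left. *)
Definition mxend M : 'End('cV[R[i]]_ell) := linfun (mulmx M).

Definition gen_eigenspace M (mu : R[i]) : {vspace 'cV[R[i]]_ell} :=
  lker (mxend ((M - mu%:M) ^+ ell)).

Definition Espace M (j : nat) : {vspace 'cV[R[i]]_ell} :=
  (\sum_(mu <- spectrum M | logabs mu == chi M j) gen_eigenspace M mu)%VS.

Definition mult M (j : nat) : nat := \dim (Espace M j).

Definition projection_family (n : nat) (P : 'I_n -> 'M[R[i]]_ell) : Prop :=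
  (forall j, P j *m P j = P j) /\ \sum_j P j = 1%:M.

Definition spectral_projections M (P : 'I_(nexp M).+1 -> 'M[R[i]]_ell) : Prop :=
  projection_family P /\ forall j, limg (mxend (P j)) = Espace M j.

End Spectral.

(* A^(N)(xi) = A(lambda^(-N+1) xi) ... A(lambda^(-1) xi) A(xi). *)
Fixpoint cocycle (R : realType) (d ell : nat) (lambda : R)
    (A : 'cV[R]_d -> 'M[R[i]]_ell) (N : nat) (xi : 'cV[R]_d) : 'M[R[i]]_ell :=
  if N is N'.+1 then A (lambda ^- N' *: xi) *m cocycle lambda A N' xi
  else 1%:M.

(* Main.v *)
Require Import Defs.
From mathcomp Require Import all_boot all_order all_algebra complex.
From mathcomp Require Import all_classical all_reals all_analysis.
From mathcomp Require Import ring lra.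

(** Put [B = A 0] and [q = lambda^-1]. Along the orbit of [xi] the factors of
    the cocycle are [B + Dl m], where [Dl m = A (q ^+ m *: xi) - B] is of size
    [O(r q^m)] for [xi] in the ball of radius [r]: a constant matrix under a
    perturbation which is uniformly small and decays geometrically. Such a
    product can be block-diagonalized along the spectral splitting of [B]. There
    are [H m] near the identity and [D m = B + O(q^m)] commuting with every
    [P j] such that [(B + Dl m) *m H m = H m.+1 *m D m]
    ([block_diagonalization], and [uniform_conjugacy] for all [xi] at once).
    Hence the cocycle times [H 0] is [H N] times the product of the [D m], and
    the projections [H 0 *m P j *m invmx (H 0)] reduce (i), (iii) and (iv) to
    products inside one block, and (ii) to the off-diagonal blocks of [H N].

    The column of [H m] over the [j]-th spectral subspace is [P j + u m], a
    bundle of graphs carried to itself. It is the fixed point of a graph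
    transform ([invariant_column]): the part of [u m] with values in the faster
    subspaces is solved backward from infinity, the part with values in the
    slower ones forward from the value zero at time [0]. Separation of the
    moduli makes both directions contracting. The backward part inherits the
    size [O(q^m)] of the perturbation; the forward part can decay no faster than
    the ratio of the two moduli, and does so up to an arbitrarily small loss
    ([offdiagonal_decay]). This is the asymmetry between the two cases of (ii).

    All contraction constants come from [adapted_norm]: for every [eps > 0]
    there is a norm in which [B] dilates the [j]-th spectral subspace by its
    modulus [rate B j] up to [eps], and exactly by it where [B] is semisimple.
    In such a norm one block of [D m] dilates by [rate B j + O(eps) + O(q^m)],
    and the factors [1 + O(q^m)] have a convergent product ([growth_le],
    [growth_ge]). Letting [eps] tend to [0] gives the subexponential estimates;
    the exact case gives those with constants. *)

Set Implicit Arguments.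
Unset Strict Implicit.
Unset Printing Implicit Defensive.

Import Order.TTheory GRing.Theory Num.Theory.
Import numFieldNormedType.Exports.

Local Open Scope classical_set_scope.
Local Open Scope ring_scope.

(** * Norms on complex column vectors *)

Section ComplexModulus.
Variable R : realType.
Implicit Types z w : R[i].

Lemma cabs_ge0 z : 0 <= cabs z.
Proof. by case: z => a b; rewrite /cabs /= sqrtr_ge0. Qed.

Lemma cabs0 : cabs (0 : R[i]) = 0. Proof. exact: Normc.normc0. Qed.

Lemma cabs1 : cabs (1 : R[i]) = 1. Proof. exact: Normc.normc1. Qed.

Lemma cabsM z w : cabs (z * w) = cabs z * cabs w.
Proof. exact: Normc.normcM. Qed.

Lemma cabs_eq0 z : cabs z = 0 -> z = 0. Proof. exact: Normc.eq0_normc. Qed.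

Lemma cabsD z w : cabs (z + w) <= cabs z + cabs w.
Proof. exact: le_normcD. Qed.

Lemma cabsN z : cabs (- z) = cabs z. Proof. exact: normcN. Qed.

Lemma cabs_real (a : R) : 0 <= a -> cabs a%:C%C = a.
Proof. by move=> a0; rewrite /cabs /= expr0n addr0 sqrtr_sqr ger0_norm. Qed.

Lemma cabs_sum (I : Type) (s : seq I) (Q : pred I) (F : I -> R[i]) :
  cabs (\sum_(i <- s | Q i) F i) <= \sum_(i <- s | Q i) cabs (F i).
Proof.
elim/big_rec2: _ => [|i y z _ le_zy]; first by rewrite cabs0.
by rewrite (le_trans (cabsD _ _)) ?lerD2l.
Qed.

Lemma cabs_ReIm z : cabs z <= `|complex.Re z| + `|complex.Im z|.
Proof.
case: z => a b; rewrite /cabs /= -(@ger0_norm _ (`|a| + `|b|)) ?addr_ge0//.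
rewrite -sqrtr_sqr ler_sqrt ?sqr_ge0// sqrrD !real_normK ?num_real//.
by have := mulr_ge0 (normr_ge0 a) (normr_ge0 b); lra.
Qed.

Lemma Re_le_cabs z : `|complex.Re z| <= cabs z.
Proof.
by case: z => a b; rewrite /cabs /= -sqrtr_sqr ler_wsqrtr// lerDl sqr_ge0.
Qed.

Lemma Im_le_cabs z : `|complex.Im z| <= cabs z.
Proof.
by case: z => a b; rewrite /cabs /= -sqrtr_sqr ler_wsqrtr// lerDr sqr_ge0.
Qed.

End ComplexModulus.

Section CNorm.
Variables (R : realType) (ell : nat).
Local Notation C := R[i].
Local Notation V := 'cV[C]_ell.
Implicit Types (nu : V -> R) (x y : V) (M N : 'M[C]_ell).

Section OneNorm.
Variable nu : V -> R.
Hypothesis hnu : is_cnorm nu.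

Lemma cnormD x y : nu (x + y) <= nu x + nu y. Proof. by case: hnu. Qed.

Lemma cnormZ (a : C) x : nu (a *: x) = cabs a * nu x.
Proof. by case: hnu. Qed.

Lemma cnorm_eq0 x : nu x = 0 -> x = 0. Proof. by case: hnu => _ _; apply. Qed.

Lemma cnorm0 : nu 0 = 0. Proof. by rewrite -(scale0r 0) cnormZ cabs0 mul0r. Qed.

Lemma cnormN x : nu (- x) = nu x.
Proof. by rewrite -scaleN1r cnormZ cabsN cabs1 mul1r. Qed.

Lemma cnorm_ge0 x : 0 <= nu x.
Proof. have := cnormD x (- x); rewrite subrr cnorm0 cnormN; lra. Qed.

Lemma cnormB x y : nu (x - y) <= nu x + nu y.
Proof. by rewrite -(cnormN y) cnormD. Qed.

Lemma cnorm_subr x y : nu x - nu y <= nu (x - y).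
Proof. by have := cnormD (x - y) y; rewrite subrK; lra. Qed.

Lemma cnorm_sum (I : Type) (s : seq I) (Q : pred I) (F : I -> V) :
  nu (\sum_(i <- s | Q i) F i) <= \sum_(i <- s | Q i) nu (F i).
Proof.
elim/big_rec2: _ => [|i y z _ le_zy]; first by rewrite cnorm0.
by rewrite (le_trans (cnormD _ _)) ?lerD2l.
Qed.

End OneNorm.

Definition l1norm x : R := \sum_i cabs (x i 0).

Lemma is_cnorm_l1norm : is_cnorm l1norm.
Proof.
split=> [x y|a x|x].
- rewrite /l1norm -big_split; apply: ler_sum => i _ /=.
  by rewrite mxE cabsD.
- by rewrite /l1norm mulr_sumr; apply: eq_bigr => i _; rewrite mxE cabsM.
- move/eqP; rewrite psumr_eq0 => [|i _]; last exact: cabs_ge0.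
  move=> /allP x0; apply/colP => i; rewrite mxE; apply/cabs_eq0/eqP.
  by apply: x0; rewrite mem_index_enum.
Qed.

Lemma cnorm_le_l1norm nu : is_cnorm nu ->
  exists K, 0 < K /\ forall x, nu x <= K * l1norm x.
Proof.
move=> hnu; pose K := 1 + \sum_i nu (delta_mx i 0).
have ge0 := cnorm_ge0 hnu; have S0 : 0 <= \sum_i nu (delta_mx i 0).
  by apply: sumr_ge0 => i _; exact: ge0.
exists K; split=> [|x]; first by rewrite /K; lra.
rewrite {1}[x]matrix_sum_delta (le_trans (cnorm_sum hnu _ _ _))// mulr_sumr.
apply: ler_sum => i _; rewrite big_ord1 (cnormZ hnu) mulrC ler_wpM2r ?cabs_ge0//.
rewrite /K (bigD1 i)//= addrCA lerDl addr_ge0//.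
by apply: sumr_ge0 => k _; exact: ge0.
Qed.

(** A complex column read from a real row of twice the size, so that compactness
    of the real unit sphere applies. *)
Let ofR (v : 'rV[R]_(ell + ell)) : V :=
  \col_i (v 0 (lshift ell i) +i* v 0 (rshift ell i))%C.

(** A norm is Lipschitz, so it attains a positive minimum on the unit sphere. *)
Lemma l1norm_le_cnorm nu : is_cnorm nu ->
  exists K, 0 < K /\ forall x, l1norm x <= K * nu x.
Proof.
move=> hnu; have [K [K0 leK]] := cnorm_le_l1norm hnu.
have coordle (v : 'rV[R]_(ell + ell)) i : `|v 0 i| <= `|v|.
  rewrite [leRHS]/Num.norm /= mx_normrE; apply: (le_bigmax _ _ (0, i)).
have ofR_le v : l1norm (ofR v) <= 2 * ell%:R * `|v|.
  rewrite -mulrA mulrC -mulrA -[X in X%:R]card_ord mulr_natl -sumr_const.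
  apply: ler_sum => i _; rewrite mxE (le_trans (cabs_ReIm _))//=.
  by rewrite mulr_natr mulr2n lerD.
have ofRB v w : ofR (v - w) = ofR v - ofR w.
  by apply/colP => i; rewrite !mxE.
have ofRZ a v : ofR (a *: v) = a%:C%C *: ofR v.
  by apply/colP => i; rewrite !mxE; simpc.
pose toR x : 'rV[R]_(ell + ell) :=
  row_mx (\row_i complex.Re (x i 0)) (\row_i complex.Im (x i 0)).
have toRK x : ofR (toR x) = x.
  by apply/colP => i; rewrite mxE row_mxEl row_mxEr !mxE; case: (x i 0).
pose f v : R := nu (ofR v).
have f_lip v w : `|f v - f w| <= K * (2 * ell%:R) * `|v - w|.
  have half a b : f a - f b <= K * (2 * ell%:R) * `|a - b|.
    rewrite (le_trans (cnorm_subr hnu _ _))// -ofRB (le_trans (leK _))//.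
    by rewrite -mulrA ler_wpM2l// ltW.
  by rewrite ler_norml half lerNl opprB distrC half.
have f_cont : continuous f.
  move=> v; apply/(@cvgrPdist_le _ _ _ (nbhs v) (nbhs_filter v)) => e e0.
  have L0 : 0 < K * (2 * ell%:R) + 1 by rewrite ltr_wpDl// mulr_ge0// ltW.
  near=> w.
  rewrite (le_trans (f_lip _ _))//.
  apply: le_trans (_ : (K * (2 * ell%:R) + 1) * `|v - w| <= _).
    by rewrite ler_wpM2r// lerDl.
  rewrite mulrC -ler_pdivlMr//; near: w.
  have /cvgrPdist_le : (fun w : 'rV[R]_(ell + ell) => w) @ v --> v by [].
  by move=> /(_ _ (divr_gt0 e0 L0)); exact.
pose S := [set v : 'rV[R]_(ell + ell) | `|v| = 1].
have [S0|/set0P S0] := eqVneq S set0.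
  exists 1; split=> // x; suff -> : x = 0.
    by rewrite (cnorm0 is_cnorm_l1norm) (cnorm0 hnu) mulr0.
  apply/eqP/negP => /negP x0; have t0 : toR x != 0.
    by apply: contra_neq x0 => t0; rewrite -(toRK x) t0 -(scale0r 0) ofRZ scale0r.
  suff : S (`|toR x|^-1 *: toR x) by rewrite S0.
  by rewrite /S /= normrZ normfV normr_id mulVf// normr_eq0.
have cS : compact S.
  apply: bounded_closed_compact.
    by exists 1; split=> // M M1 v /= ->; exact: ltW.
  rewrite (_ : S = (@Num.norm R _) @^-1` [set 1])//.
  by apply: preimage_closed => [? _|]; [exact: norm_continuous|exact: closed_eq].
have [v Sv minv] : exists2 c, c \in S & forall t, t \in S -> f c <= f t.
  by apply: EVT_min_rV => //; exact: continuous_subspaceT.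
have fv : 0 < f v.
  rewrite lt0r cnorm_ge0// andbT; apply/negP => /eqP/(cnorm_eq0 hnu) v0.
  suff v00 : v = 0.
    by move: Sv; rewrite inE /S /= v00 normr0 => /eqP; rewrite eq_sym oner_eq0.
  apply/rowP => i; rewrite mxE; case: (split_ordP i) => k ->.
    by move/colP/(_ k): v0; rewrite !mxE => -[->].
  by move/colP/(_ k): v0; rewrite !mxE => -[_ ->].
exists ((2 * ell%:R + 1) / f v); split.
  by rewrite divr_gt0// ltr_wpDl// mulr_ge0.
move=> x; have [t0|t0] := eqVneq (toR x) 0.
  have -> : x = 0 by rewrite -(toRK x) t0 -(scale0r 0) ofRZ scale0r.
  by rewrite (cnorm0 is_cnorm_l1norm) (cnorm0 hnu) mulr0.
have := minv (`|toR x|^-1 *: toR x).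
rewrite inE /S /= normrZ normfV normr_id mulVf ?normr_eq0// => /(_ erefl).
rewrite /f ofRZ toRK (cnormZ hnu) cabs_real ?invr_ge0// mulrC.
rewrite ler_pdivlMr ?normr_gt0// => le1.
rewrite -{1}(toRK x) (le_trans (ofR_le _))// -[leRHS]mulrA.
apply: ler_pM; rewrite ?mulr_ge0 ?normr_ge0 ?lerDl//.
by rewrite [leRHS]mulrC ler_pdivlMr// mulrC.
Unshelve. all: by end_near.
Qed.

Lemma cnorm_equiv nu nu' : is_cnorm nu -> is_cnorm nu' ->
  exists K, 0 < K /\ forall x, nu x <= K * nu' x.
Proof.
move=> /cnorm_le_l1norm[K [K0 leK]] /l1norm_le_cnorm[K' [K'0 leK']].
exists (K * K'); split=> [|x]; first exact: mulr_gt0.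
by rewrite (le_trans (leK x))// -mulrA ler_wpM2l// ltW.
Qed.

End CNorm.

(** * Geometric limits and operator bounds *)

Section GeometricLimits.
Variable R : realType.

(** Shifting [x i] down and up by the tail of the geometric series gives
    nested intervals, and [sup] of the lower ends is the limit. *)
Lemma geometric_limit (x : nat -> R) (e t : R) : 0 <= t < 1 ->
  (forall i, `|x i.+1 - x i| <= e * t ^+ i) ->
  exists l, forall i, `|l - x i| <= e / (1 - t) * t ^+ i.
Proof.
move=> /andP[t0 t1] dx; pose r i := e / (1 - t) * t ^+ i.
have rS i : r i - r i.+1 = e * t ^+ i.
  by rewrite /r exprS; field; lra.
pose lo i := x i - r i; pose up i := x i + r i.
have loS : {homo lo : i k / (i <= k)%N >-> i <= k}.
  apply/nondecreasing_seqP => i.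
  by have := dx i; rewrite ler_norml -rS /lo => /andP[]; lra.
have upS : {homo up : i k / (i <= k)%N >-> k <= i}.
  apply/nonincreasing_seqP => i.
  by have := dx i; rewrite ler_norml -rS /up => /andP[]; lra.
have r0 i : 0 <= r i.
  rewrite mulr_ge0 ?exprn_ge0// divr_ge0//; last by lra.
  by have := dx 0%N; rewrite expr0 mulr1; apply: le_trans.
have lo_up i k : lo i <= up k.
  apply: le_trans (loS _ _ (leq_maxl i k)) _.
  apply: le_trans (upS _ _ (leq_maxr i k)).
  by rewrite /lo /up; have := r0 (maxn i k); lra.
have hs : has_sup (range lo).
  by split; [exists (lo 0%N), 0%N|exists (up 0%N) => _ [i _ <-]; exact: lo_up].
exists (sup (range lo)) => i; rewrite -/(r i) ler_distl; apply/andP; split.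
  by apply: ub_le_sup; [case: hs|exists i].
by apply: ge_sup => [|_ [k _ <-]]; [case: hs|exact: lo_up].
Qed.

End GeometricLimits.

Lemma mulmx_col_inj (T : pzRingType) (m n : nat) (M M' : 'M[T]_(m, n)) :
  (forall x : 'cV[T]_n, M *m x = M' *m x) -> M = M'.
Proof.
move=> MM; apply/matrixP => a b; have /colP/(_ a) := MM (delta_mx b 0).
by rewrite -!colE !mxE.
Qed.

Section OperatorBounds.
Variables (R : realType) (ell : nat).
Local Notation C := R[i].
Local Notation V := 'cV[C]_ell.
Implicit Types (x y : V) (M N : 'M[C]_ell).

(** An upper bound for the operator norm of [M]; as a relation it needs no
    supremum, and every estimate below is of this form. *)
Definition opbound (nu : V -> R) M (c : R) := forall x, nu (M *m x) <= c * nu x.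

Variable nu : V -> R.
Hypothesis hnu : is_cnorm nu.
Local Notation opb := (opbound nu).

Let ge0 := cnorm_ge0 hnu.

Lemma opbound_le M a b : opb M a -> a <= b -> opb M b.
Proof. by move=> Ma ab x; rewrite (le_trans (Ma x))// ler_wpM2r. Qed.

Lemma opboundD M N a b : opb M a -> opb N b -> opb (M + N) (a + b).
Proof.
move=> Ma Nb x; rewrite mulmxDl mulrDl (le_trans (cnormD hnu _ _))//.
exact: lerD.
Qed.

Lemma opboundN M a : opb M a -> opb (- M) a.
Proof. by move=> Ma x; rewrite mulNmx (cnormN hnu). Qed.

Lemma opboundB M N a b : opb M a -> opb N b -> opb (M - N) (a + b).
Proof. by move=> Ma /opboundN; exact: opboundD. Qed.

Lemma opboundM M N a b : 0 <= a -> opb M a -> opb N b -> opb (M *m N) (a * b).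
Proof.
move=> a0 Ma Nb x; rewrite -mulmxA (le_trans (Ma _))// -mulrA.
by rewrite ler_wpM2l.
Qed.

Lemma opbound0 a : 0 <= a -> opb 0 a.
Proof. by move=> a0 x; rewrite mul0mx (cnorm0 hnu) mulr_ge0. Qed.

Lemma opbound_closed M a : (forall e, 0 < e -> opb M (a + e)) -> opb M a.
Proof.
move=> Mae x; apply/ler_addgt0Pr => e e0.
have d0 : 0 < e / (nu x + 1) by rewrite divr_gt0// ltr_wpDl.
rewrite (le_trans (Mae _ d0 x))// mulrDl lerD2l mulrAC -mulrA.
by rewrite ler_piMr ?ltW// ltr_pdivrMr ?ltr_wpDl// mul1r ltrDl.
Qed.

Lemma opbound_eq0 M : (forall e, 0 < e -> opb M e) -> M = 0.
Proof.
move=> Me; have M0 : opb M 0.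
  by apply: opbound_closed => e; rewrite add0r; exact: Me.
apply: mulmx_col_inj => x; rewrite mul0mx; apply: (cnorm_eq0 hnu).
by apply/eqP; rewrite eq_le ge0 andbT -(mul0r (nu x)).
Qed.

Lemma entries_le_opbound : exists K, 0 < K /\ forall M c, opb M c ->
  forall i j, cabs (M i j) <= K * c.
Proof.
have [K [K0 leK]] := l1norm_le_cnorm hnu.
pose S := 1 + \sum_j nu (delta_mx j 0); have S0 : 0 < S.
  by rewrite ltr_pwDl// sumr_ge0.
exists (K * S); split=> [|M c Mc i j]; first exact: mulr_gt0.
have le1 : cabs (M i j) <= l1norm (M *m delta_mx j 0).
  rewrite /l1norm (bigD1 i)//= -colE mxE lerDl sumr_ge0// => k _.
  exact: cabs_ge0.
rewrite (le_trans le1)// (le_trans (leK _))// -mulrA ler_wpM2l ?(ltW K0)//.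
have [c0|c0] := leP 0 c; last first.
  have nd : nu (delta_mx j 0) <= 0.
    rewrite leNgt; apply/negP => nd.
    by have := le_trans (ge0 _) (Mc (delta_mx j 0)); rewrite leNgt pmulr_llt0// c0.
  have /matrixP/(_ j 0) : delta_mx j 0 = 0 :> V.
    by apply: (cnorm_eq0 hnu); apply/eqP; rewrite eq_le nd ge0.
  by rewrite !mxE !eqxx => /eqP; rewrite oner_eq0.
rewrite (le_trans (Mc _))// mulrC ler_wpM2r// /S (bigD1 j)//= addrCA lerDl.
by rewrite addr_ge0// sumr_ge0.
Qed.

Lemma opbound_le_entries : exists K, 0 < K /\ forall M c,
  (forall i j, cabs (M i j) <= c) -> opb M (K * c).
Proof.
have [K [K0 leK]] := cnorm_le_l1norm hnu.
have [K' [K'0 leK']] := l1norm_le_cnorm hnu.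
exists (K * (ell%:R + 1) * K'); split=> [|M c Mc x].
  by rewrite !mulr_gt0// ltr_wpDl.
have [->|x0] := eqVneq x 0; first by rewrite mulmx0 (cnorm0 hnu) mulr0.
have c0 : 0 <= c.
  case: (pickP (fun i : 'I_ell => true)) => [i _|none].
    exact: le_trans (cabs_ge0 _) (Mc i i).
  by case/eqP: x0; apply/colP => i; have := none i.
have le1 : l1norm (M *m x) <= (ell%:R * c) * l1norm x.
  rewrite -mulrA -[X in X%:R]card_ord mulr_natl -sumr_const.
  apply: ler_sum => i _; rewrite mxE (le_trans (cabs_sum _ _ _))// mulr_sumr.
  by apply: ler_sum => j _; rewrite cabsM ler_wpM2r ?cabs_ge0.
rewrite (le_trans (leK _))// -!mulrA ler_wpM2l ?(ltW K0)// (le_trans le1)//.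
rewrite -mulrA; apply: ler_pM => //; first by rewrite mulr_ge0// sumr_ge0// => i _; exact: cabs_ge0.
  by rewrite lerDl.
by rewrite mulrCA ler_wpM2l.
Qed.

Lemma matrix_geometric_limit (M : nat -> 'M[C]_ell) (e t : R) : 0 <= t < 1 ->
  (forall i, opb (M i.+1 - M i) (e * t ^+ i)) ->
  exists (L : 'M[C]_ell) K, 0 <= K /\ forall i, opb (L - M i) (K * t ^+ i).
Proof.
move=> t01 dM; have [K [K0 entK]] := entries_le_opbound.
have [K' [K'0 opbK']] := opbound_le_entries.
have ent i a b : cabs (M i.+1 a b - M i a b) <= (K * e) * t ^+ i.
  by have := entK _ _ (dM i) a b; rewrite !mxE mulrA.
have re a b : exists l, forall i,
    `|l - complex.Re (M i a b)| <= K * e / (1 - t) * t ^+ i.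
  apply: geometric_limit => // i; apply: le_trans (ent i a b).
  by apply: le_trans (Re_le_cabs _); rewrite raddfB.
have im a b : exists l, forall i,
    `|l - complex.Im (M i a b)| <= K * e / (1 - t) * t ^+ i.
  apply: geometric_limit => // i; apply: le_trans (ent i a b).
  by apply: le_trans (Im_le_cabs _); rewrite raddfB.
pose L : 'M[C]_ell := \matrix_(a, b) (sval (cid (re a b)) +i* sval (cid (im a b)))%C.
pose c := K * e / (1 - t) *+ 2.
have LM i : opb (L - M i) (K' * (`|c| * t ^+ i)).
  apply: opbK' => a b; rewrite !mxE (le_trans (cabs_ReIm _))//=.
  case: (cid (re a b)) (cid (im a b)) => /= u hu [v hv].
  case E : (M i a b) (hu i) (hv i) => [p q] /= hp hq.
  rewrite (le_trans (lerD hp hq))// -mulrDl -mulr2n ler_wpM2r ?ler_norm//.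
  by rewrite exprn_ge0//; case/andP: t01.
exists L, (K' * `|c|); split; first by rewrite mulr_ge0// ltW.
by move=> i; rewrite -mulrA.
Qed.

End OperatorBounds.

(** * The graph transform over one spectral subspace *)

Section RealGeometric.
Variable R : realType.

Lemma geometric_small (K t e : R) : 0 <= K -> 0 <= t < 1 -> 0 < e ->
  exists i0 : nat, forall i, (i0 <= i)%N -> K * t ^+ i <= e.
Proof.
move=> K0 /andP[t0 t1] e0.
have /cvgrPdist_le/(_ (e / (K + 1))) : (fun i => t ^+ i) @ \oo --> (0 : R).
  by apply: cvg_expr; rewrite ger0_norm.
have K1 : 0 < K + 1 by rewrite ltr_wpDl.
move=> /(_ (divr_gt0 e0 K1))[i0 _ hi]; exists i0 => i /hi /=.
rewrite sub0r normrN ger0_norm ?exprn_ge0// ler_pdivlMr// mulrC => le1.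
by apply: le_trans le1; rewrite ler_wpM2r ?exprn_ge0// lerDl.
Qed.

End RealGeometric.

Section EntrywiseAddition.
Variables (W : zmodType) (m n : nat).
Implicit Types M N : 'M[W]_(m, n).

Lemma addmx_entry M N i j : (M + N) i j = M i j + N i j.
Proof. by rewrite mxE. Qed.

Lemma oppmx_entry M i j : (- M) i j = - M i j.
Proof. by rewrite mxE. Qed.

Lemma zeromx_entry i j : (0 : 'M[W]_(m, n)) i j = 0.
Proof. by rewrite mxE. Qed.

End EntrywiseAddition.

Ltac mx_abel :=
  repeat match goal with
  | |- context [@mulmx ?S ?a ?b ?c ?A ?B] => move: (@mulmx S a b c A B) => ?
  end;
  apply/matrixP => ? ?;
  rewrite ?(addmx_entry, oppmx_entry, zeromx_entry); ring.

Section InvariantColumn.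
Variables (R : realType) (ell : nat) (nu : 'cV[R[i]]_ell -> R).
Hypothesis hnu : is_cnorm nu.
Local Notation mx := 'M[R[i]]_ell.
Local Notation opb := (opbound nu).

Variables (B G pf pj ps : mx) (g kappa rho q eta : R) (Dl : nat -> mx).
(* [pf], [pj] and [ps] project onto the faster, the given and the slower
   subspaces, and [G] inverts [B] *)
Hypothesis p_sum : pf + pj + ps = 1%:M.
Hypotheses (pff : pf *m pf = pf) (pjj : pj *m pj = pj) (pss : ps *m ps = ps).
Hypotheses (pfj : pf *m pj = 0) (pfs : pf *m ps = 0) (pjf : pj *m pf = 0).
Hypotheses (pjs : pj *m ps = 0) (psf : ps *m pf = 0) (psj : ps *m pj = 0).
Hypotheses (Bf : pf *m B = B *m pf) (Bj : pj *m B = B *m pj).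
Hypotheses (Bs : ps *m B = B *m ps) (Gf : pf *m G = G *m pf).
Hypothesis BGf : B *m G *m pf = pf.
(* the slowest block, for which [ps = 0], may be singular *)
Hypothesis GBj : ps = 0 \/ G *m pj *m B = pj.
Hypotheses (pf1 : opb pf 1) (pj1 : opb pj 1) (ps1 : opb ps 1) (Gg : opb G g).
Hypotheses (g0 : 0 <= g) (kappa01 : 0 <= kappa < 1) (rho01 : 0 < rho <= 1).
Hypotheses (q01 : 0 < q < 1) (eta0 : 0 <= eta).
Hypothesis eta_small : 24 * g * eta <= (1 - kappa) * rho.
Hypothesis fcontr : forall X c, 0 <= c ->
  opb (pf *m X) c -> opb (pf *m G *m X *m B *m pj) (kappa * c).
Hypothesis scontr : forall X c, 0 <= c ->
  opb (ps *m X) c -> opb (ps *m B *m X *m G *m pj) (kappa * c).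
Hypothesis Dl_small : forall m, opb (Dl m) (eta * q ^+ m).

Let kappa0 : 0 <= kappa. Proof. by case/andP: kappa01. Qed.
Let rho0 : 0 <= rho. Proof. by case/andP: rho01 => /ltW. Qed.
Let rho1 : rho <= 1. Proof. by case/andP: rho01. Qed.
Let q0 : 0 <= q. Proof. by case/andP: q01 => /ltW. Qed.
Let q1 : q <= 1. Proof. by case/andP: q01 => _ /ltW. Qed.
Let qm0 m : 0 <= q ^+ m. Proof. exact: exprn_ge0. Qed.
Let qm1 m : q ^+ m <= 1. Proof. exact: exprn_ile1. Qed.
Let ler0n2 : 0 <= 2 :> R. Proof. by []. Qed.
Let Dl_eta m : opb (Dl m) eta.
Proof. by apply: (opbound_le hnu (Dl_small m)); rewrite ler_piMr. Qed.

Implicit Types u v : nat -> mx.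

(** [B *m pj + block_drift u m] is the block through which [B + Dl m] acts on
    the graph of [u m] when the sequence [u] is invariant. *)
Local Definition block_drift u m : mx := pj *m Dl m *m (pj + u m).
(** What distinguishes the invariance equation for [u] from the linear one
    [u m.+1 *m B = B *m u m]; it enters the two components with opposite signs. *)
Local Definition remainder u m : mx := u m.+1 *m block_drift u m - Dl m *m (pj + u m).
(** The component in the fast directions is recovered from time [m.+1], where
    [G] inverts [B]; the slow component is pushed forward from time [m.-1]. *)
Local Definition fast_part u m : mx := pf *m G *m (u m.+1 *m B + remainder u m) *m pj.
Local Definition slow_part u m : mx :=
  if m is m'.+1 then ps *m (B *m u m' - remainder u m') *m G *m pj else 0.

(** The fast component must keep the decay of the perturbation; the slow one
    is only bounded. *)
Local Definition admissible u := forall m, [/\ u m *m pj = u m, pj *m u m = 0,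
  opb (pf *m u m) (rho * q ^+ m) & opb (ps *m u m) rho].

Let split u m : pj *m u m = 0 -> u m = pf *m u m + ps *m u m.
Proof. by move=> h; rewrite -{1}(mul1mx (u m)) -p_sum !mulmxDl h addr0. Qed.

Let good_bound u m : admissible u -> opb (u m) 2.
Proof.
move=> /(_ m)[_ uj uf us]; rewrite (split uj); apply: (opbound_le hnu (opboundD hnu uf us)).
have : rho * q ^+ m <= rho by rewrite ler_piMr.
by move: rho1; lra.
Qed.

Let good_bound3 u m : admissible u -> opb (pj + u m) 3.
Proof.
by move=> /(good_bound m) h; apply: (opbound_le hnu) (opboundD hnu pj1 h) _; lra.
Qed.

Let drift_bound u m : admissible u -> opb (block_drift u m) (3 * eta * q ^+ m).
Proof.
move=> /(good_bound3 m) h; rewrite /block_drift -mulmxA.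
have h' := opboundM (mulr_ge0 eta0 (qm0 m)) (Dl_small m) h.
by apply: (opbound_le hnu (opboundM ler01 pj1 h'));
  rewrite mul1r; lra.
Qed.

Let err_bound u m : admissible u -> opb (remainder u m) (9 * eta * q ^+ m).
Proof.
move=> gu.
have h1 := opboundM ler0n2 (good_bound m.+1 gu) (drift_bound m gu).
have h2 := opboundM (mulr_ge0 eta0 (qm0 m)) (Dl_small m) (good_bound3 m gu).
by apply: (opbound_le hnu (opboundB hnu h1 h2)); lra.
Qed.

Let err_diff u v m e : admissible u -> admissible v -> 0 <= e ->
  opb (u m - v m) (2 * e) -> opb (u m.+1 - v m.+1) (2 * e) ->
  opb (remainder u m - remainder v m) (12 * eta * e).
Proof.
move=> gu gv e0 uv uvS.
have -> : remainder u m - remainder v m = (u m.+1 - v m.+1) *m block_drift u m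
    + v m.+1 *m (pj *m Dl m *m (u m - v m)) - Dl m *m (u m - v m).
  rewrite /remainder /block_drift !(mulmxDl, mulmxDr, mulmxBl, mulmxBr, mulNmx, mulmxN) !mulmxA.
  by mx_abel.
have d3 : opb (block_drift u m) (3 * eta).
  apply: (opbound_le hnu (drift_bound m gu)).
  by rewrite ler_piMr// mulr_ge0.
have dd : opb (pj *m Dl m *m (u m - v m)) (eta * (2 * e)).
  rewrite -mulmxA -[eta * _]mul1r; apply: (opboundM) => //.
  exact: (opboundM).
have e2 : 0 <= 2 * e by rewrite mulr_ge0.
have h1 := opboundM e2 uvS d3.
have h2 := opboundM ler0n2 (good_bound m.+1 gv) dd.
have h3 := opboundM eta0 (Dl_eta m) uv.
by apply: (opbound_le hnu (opboundB hnu (opboundD hnu h1 h2) h3)); lra.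
Qed.

Local Definition contraction_factor := kappa + 12 * g * eta.
Let theta01 : 0 <= contraction_factor < 1.
Proof.
have ge : 0 <= g * eta by rewrite mulr_ge0.
rewrite /contraction_factor; case/andP: kappa01 => k0 k1.
have : (1 - kappa) * rho <= 1 - kappa by rewrite ler_piMr// subr_ge0 ltW.
by move: eta_small k0 k1 ge => ? ? ? ? ?; apply/andP; split; lra.
Qed.

Let fast_diff u v m e : admissible u -> admissible v -> 0 <= e ->
  opb (pf *m (u m.+1 - v m.+1)) e ->
  opb (u m - v m) (2 * e) -> opb (u m.+1 - v m.+1) (2 * e) ->
  opb (fast_part u m - fast_part v m) (contraction_factor * e).
Proof.
move=> gu gv e0 uvf uv uvS.
have -> : fast_part u m - fast_part v m = pf *m G *m (u m.+1 - v m.+1) *m B *m pj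
    + pf *m (G *m ((remainder u m - remainder v m) *m pj)).
  rewrite /fast_part; move: (remainder u m) (remainder v m) (u m.+1) (v m.+1) => a b c d.
  by rewrite !(mulmxDl, mulmxDr, mulmxBl, mulmxBr, mulNmx, mulmxN) !mulmxA; mx_abel.
have h := opboundM (mulr_ge0 (mulr_ge0 (ler0n _ 12) eta0) e0)
            (err_diff gu gv e0 uv uvS) pj1.
have h' := opboundM ler01 pf1 (opboundM g0 Gg h).
by apply: (opbound_le hnu (opboundD hnu (fcontr e0 uvf) h')); rewrite /contraction_factor; lra.
Qed.

Let slow_diff u v m e : admissible u -> admissible v -> 0 <= e ->
  opb (ps *m (u m - v m)) e ->
  opb (u m - v m) (2 * e) -> opb (u m.+1 - v m.+1) (2 * e) ->
  opb (slow_part u m.+1 - slow_part v m.+1) (contraction_factor * e).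
Proof.
move=> gu gv e0 uvs uv uvS.
have -> : slow_part u m.+1 - slow_part v m.+1 = ps *m B *m (u m - v m) *m G *m pj
    - ps *m ((remainder u m - remainder v m) *m (G *m pj)).
  rewrite /slow_part; move: (remainder u m) (remainder v m) (u m) (v m) => a b c d.
  by rewrite !(mulmxDl, mulmxDr, mulmxBl, mulmxBr, mulNmx, mulmxN) !mulmxA; mx_abel.
have h := opboundM (mulr_ge0 (mulr_ge0 (ler0n _ 12) eta0) e0)
            (err_diff gu gv e0 uv uvS) (opboundM g0 Gg pj1).
have h' := opboundM ler01 ps1 h.
by apply: (opbound_le hnu (opboundB hnu (scontr e0 uvs) h')); rewrite /contraction_factor; lra.
Qed.

Local Definition graph_transform u m : mx := fast_part u m + slow_part u m.

Let pf_step u m : pf *m graph_transform u m = fast_part u m.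
Proof.
rewrite /graph_transform mulmxDr /fast_part /slow_part !mulmxA pff; case: m => [|m].
  by rewrite mulmx0 addr0.
by rewrite !mulmxA pfs !mul0mx addr0.
Qed.

Let ps_step u m : ps *m graph_transform u m = slow_part u m.
Proof.
rewrite /graph_transform mulmxDr /fast_part /slow_part !mulmxA psf !mul0mx add0r; case: m => [|m].
  by rewrite mulmx0.
by rewrite !mulmxA pss.
Qed.

Let good_step u : admissible u -> admissible (graph_transform u).
Proof.
move=> gu m; split.
- rewrite /graph_transform mulmxDl /fast_part -[in LHS]mulmxA pjj; congr (_ + _).
  by rewrite /slow_part; case: m => [|m]; rewrite ?mul0mx// -mulmxA pjj.
- rewrite /graph_transform mulmxDr /fast_part /slow_part !mulmxA pjf !mul0mx add0r.
  by case: m => [|m]; rewrite ?mulmx0// !mulmxA pjs !mul0mx.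
- rewrite pf_step /fast_part.
  have -> : pf *m G *m (u m.+1 *m B + remainder u m) *m pj =
      pf *m G *m u m.+1 *m B *m pj + pf *m (G *m (remainder u m *m pj)).
    by rewrite !(mulmxDl, mulmxDr) !mulmxA.
  have c0 : 0 <= 9 * eta * q ^+ m by rewrite !mulr_ge0.
  have h := opboundM ler01 pf1 (opboundM g0 Gg (opboundM c0 (err_bound m gu) pj1)).
  have [_ _ uf _] := gu m.+1.
  have h' := fcontr (mulr_ge0 rho0 (qm0 _)) uf.
  apply: (opbound_le hnu (opboundD hnu h' h)).
  have : rho * q ^+ m.+1 <= rho * q ^+ m by rewrite exprS ler_wpM2l// ler_piMl.
  move/(ler_wpM2l kappa0) => le1.
  have : 24 * g * eta * q ^+ m <= (1 - kappa) * rho * q ^+ m by rewrite ler_wpM2r.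
  have : 0 <= g * eta * q ^+ m by rewrite !mulr_ge0.
  by lra.
- rewrite ps_step /slow_part; case: m => [|m]; first exact: (opbound0 hnu).
  have -> : ps *m (B *m u m - remainder u m) *m G *m pj =
      ps *m B *m u m *m G *m pj - ps *m (remainder u m *m (G *m pj)).
    by rewrite !(mulmxDl, mulmxDr, mulmxN, mulNmx) !mulmxA.
  have c0 : 0 <= 9 * eta * q ^+ m by rewrite !mulr_ge0.
  have h := opboundM ler01 ps1 (opboundM c0 (err_bound m gu) (opboundM g0 Gg pj1)).
  have [_ _ _ us] := gu m.
  apply: (opbound_le hnu (opboundB hnu (scontr rho0 us) h)).
  have ge : 0 <= g * eta by rewrite mulr_ge0.
  have := ler_piMr ge (qm1 m).
  by move: eta_small; lra.
Qed.

Let good0 : admissible (fun=> 0).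
Proof.
move=> m; rewrite mul0mx !mulmx0; split=> //; apply: (opbound0 hnu) => //.
by rewrite mulr_ge0.
Qed.

Let proj_diff u v m e : admissible u -> admissible v ->
  opb (pf *m (u m - v m)) e -> opb (ps *m (u m - v m)) e ->
  opb (u m - v m) (2 * e).
Proof.
move=> /(_ m)[_ uj _ _] /(_ m)[_ vj _ _] hf hs.
have -> : u m - v m = pf *m (u m - v m) + ps *m (u m - v m).
  by apply: (@split (fun m => u m - v m)); rewrite mulmxBr uj vj subrr.
by rewrite mulr2n mulrDl mul1r; exact: (opboundD hnu).
Qed.

Let step_diff u v e : admissible u -> admissible v -> 0 <= e ->
  (forall m, opb (pf *m (u m - v m)) e /\ opb (ps *m (u m - v m)) e) ->
  forall m, opb (pf *m (graph_transform u m - graph_transform v m)) (contraction_factor * e) /\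
            opb (ps *m (graph_transform u m - graph_transform v m)) (contraction_factor * e).
Proof.
move=> gu gv e0 uv m.
have uv2 k : opb (u k - v k) (2 * e).
  by have [hf hs] := uv k; exact: (proj_diff gu gv hf hs).
have [hf _] := uv m.+1.
split=> x; rewrite mulmxBr.
  have -> : pf *m graph_transform u m - pf *m graph_transform v m = fast_part u m - fast_part v m.
    exact: (f_equal2 (fun a b => a - b) (pf_step u m) (pf_step v m)).
  exact: (fast_diff gu gv e0 hf (uv2 m) (uv2 m.+1)).
have -> : ps *m graph_transform u m - ps *m graph_transform v m = slow_part u m - slow_part v m.
  exact: (f_equal2 (fun a b => a - b) (ps_step u m) (ps_step v m)).
case: m {hf} => [|m].
  rewrite subr0; apply: (opbound0 hnu); apply: mulr_ge0 => //.
  by case/andP: theta01.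
by have [_ hs] := uv m; exact: (slow_diff gu gv e0 hs (uv2 m) (uv2 m.+1)).
Qed.

Let iterates : exists w : nat -> nat -> mx, [/\ forall m, w 0%N m = 0,
  forall i m, w i.+1 m = graph_transform (w i) m & forall i, admissible (w i)].
Proof.
exists (fun i => iter i graph_transform (fun=> 0)); split=> [||i]; [by []|by []|].
by elim: i => [|i ih]; [exact: good0|exact: good_step].
Qed.

(** The graph transform maps admissible sequences to themselves and contracts
    the distance of the two components, so Picard iteration from the zero
    sequence converges; being a fixed point is the invariance equation, read in
    the fast, the central and the slow component. *)
Lemma invariant_column : exists u : nat -> mx, forall m,
  [/\ u m *m pj = u m /\ pj *m u m = 0,
      opb (pf *m u m) (rho * q ^+ m), opb (ps *m u m) rho &
      (B + Dl m) *m (pj + u m) =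
      (pj + u m.+1) *m (B *m pj + pj *m Dl m *m (pj + u m))].
Proof.
have [w [w0 wS gw]] := iterates.
have th0 : 0 <= contraction_factor by case/andP: theta01.
have wd i : forall m, opb (pf *m (w i.+1 m - w i m)) (2 * contraction_factor ^+ i) /\
                      opb (ps *m (w i.+1 m - w i m)) (2 * contraction_factor ^+ i).
  elim: i => [|i ih] m.
    rewrite expr0 mulr1 w0 subr0; have [_ _ hf hs] := gw 1%N m.
    split; first apply: (opbound_le hnu hf); last apply: (opbound_le hnu hs).
      by have : rho * q ^+ m <= rho by [rewrite ler_piMr]; move: rho1; lra.
    by move: rho1; lra.
  have e0 : 0 <= 2 * contraction_factor ^+ i by rewrite mulr_ge0// exprn_ge0.
  have := step_diff (gw i.+1) (gw i) e0 ih m.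
  by rewrite -(wS i.+1) -(wS i) exprS [contraction_factor * (2 * _)]mulrCA.
have wd4 i m : opb (w i.+1 m - w i m) (4 * contraction_factor ^+ i).
  have [hf hs] := wd i m.
  by have := proj_diff (gw i.+1) (gw i) hf hs; rewrite mulrA -natrM.
have lim m : exists L : mx, forall e, 0 < e -> exists i0 : nat,
    forall i, (i0 <= i)%N -> opb (L - w i m) e.
  have [L [K [K0 LK]]] := matrix_geometric_limit hnu theta01 (fun i => wd4 i m).
  exists L => e e0; have [i0 hi0] := geometric_small K0 theta01 e0.
  by exists i0 => i /hi0; exact: (opbound_le hnu).
have [u uP] : exists u : nat -> mx, forall m e, 0 < e -> exists i0 : nat,
    forall i, (i0 <= i)%N -> opb (u m - w i m) e.
  by exists (fun m => sval (cid (lim m))) => m; exact: (svalP (cid (lim m))).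
have gu : admissible u.
  move=> m; split.
  - apply/eqP; rewrite -subr_eq0; apply/eqP; apply: (opbound_eq0 hnu) => e e0.
    have [i /(_ _ (leqnn i)) h] := uP m _ (divr_gt0 e0 (ltr0n R 2)).
    have [ij _ _ _] := gw i m.
    have -> : u m *m pj - u m = (u m - w i m) *m pj - (u m - w i m).
      by rewrite mulmxBl ij opprB addrA subrK.
    have e20 : 0 <= e / 2 by rewrite divr_ge0// ltW.
    by apply: (opbound_le hnu (opboundB hnu (opboundM e20 h pj1) h)); lra.
  - apply: (opbound_eq0 hnu) => e e0.
    have [i /(_ _ (leqnn i)) h] := uP m _ e0.
    have [_ ij _ _] := gw i m.
    have -> : pj *m u m = pj *m (u m - w i m) by rewrite mulmxBr ij subr0.
    by rewrite -[e]mul1r; exact: opboundM.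
  - apply: (opbound_closed hnu) => e e0.
    have [i /(_ _ (leqnn i)) h] := uP m _ e0.
    have [_ _ ij _] := gw i m.
    have -> : pf *m u m = pf *m w i m + pf *m (u m - w i m).
      by rewrite mulmxBr addrC subrK.
    by apply: (opboundD hnu) => //; rewrite -[e]mul1r; exact: opboundM.
  - apply: (opbound_closed hnu) => e e0.
    have [i /(_ _ (leqnn i)) h] := uP m _ e0.
    have [_ _ _ ij] := gw i m.
    have -> : ps *m u m = ps *m w i m + ps *m (u m - w i m).
      by rewrite mulmxBr addrC subrK.
    by apply: (opboundD hnu) => //; rewrite -[e]mul1r; exact: opboundM.
have near e m : 0 < e -> exists i, [/\ opb (u m - w i m) e,
    opb (u m.+1 - w i m.+1) e, opb (u m - w i.+1 m) e &
    opb (u m.+1 - w i.+1 m.+1) e].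
  move=> e0; have [i hi] := uP m e e0; have [k hk] := uP m.+1 e e0.
  by exists (maxn i k); split; [apply: hi|apply: hk|apply: hi|apply: hk];
    rewrite ?leq_maxl ?leq_maxr// leqW// ?leq_maxl ?leq_maxr.
have th1 : contraction_factor <= 1 by case/andP: theta01 => _ /ltW.
have bnd2 M e : 0 <= e -> opb M e -> opb M (2 * e).
  by move=> e0 h; apply: (opbound_le hnu h); lra.
have bndp p M e : opb p 1 -> opb M e -> opb (p *m M) e.
  by move=> p1 h; rewrite -[e]mul1r; exact: opboundM.
have fixf m : pf *m u m = fast_part u m.
  apply/eqP; rewrite -subr_eq0; apply/eqP; apply: (opbound_eq0 hnu) => e e0.
  have e20 := divr_gt0 e0 (ltr0n R 2); have e20' := ltW e20.
  have [i [h1 h2 h3 _]] := near _ m e20.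
  have -> : pf *m u m - fast_part u m = pf *m (u m - w i.+1 m)
      - (fast_part u m - fast_part (w i) m).
    by rewrite mulmxBr (wS i) (pf_step (w i) m) opprB addrA subrK.
  have h := fast_diff gu (gw i) e20' (bndp _ _ _ pf1 h2)
    (bnd2 _ _ e20' h1) (bnd2 _ _ e20' h2).
  apply: (opbound_le hnu (opboundB hnu (bndp _ _ _ pf1 h3) h)).
  by have := ler_piMl e20' th1; lra.
have fixs m : ps *m u m.+1 = slow_part u m.+1.
  apply/eqP; rewrite -subr_eq0; apply/eqP; apply: (opbound_eq0 hnu) => e e0.
  have e20 := divr_gt0 e0 (ltr0n R 2); have e20' := ltW e20.
  have [i [h1 h2 _ h3]] := near _ m e20.
  have -> : ps *m u m.+1 - slow_part u m.+1 = ps *m (u m.+1 - w i.+1 m.+1)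
      - (slow_part u m.+1 - slow_part (w i) m.+1).
    by rewrite mulmxBr (wS i) (ps_step (w i) m.+1) opprB addrA subrK.
  have h := slow_diff gu (gw i) e20' (bndp _ _ _ ps1 h1)
    (bnd2 _ _ e20' h1) (bnd2 _ _ e20' h2).
  apply: (opbound_le hnu (opboundB hnu (bndp _ _ _ ps1 h3) h)).
  by have := ler_piMl e20' th1; lra.
exists u => m; have [uj ju uf us] := gu m; have [uj' ju' _ _] := gu m.+1.
split=> //.
have colj : (pj + u m) *m pj = pj + u m by rewrite mulmxDl pjj uj.
have errj : remainder u m *m pj = remainder u m.
  by rewrite /remainder /block_drift mulmxBl -!mulmxA colj.
have err_eq : Dl m *m (pj + u m) = u m.+1 *m block_drift u m - remainder u m.
  by rewrite /remainder opprB addrCA subrr addr0.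
have Bu : u m.+1 *m (B *m pj) = u m.+1 *m B by rewrite -Bj mulmxA uj'.
have zf : pf *m (B *m pj) = 0 by rewrite mulmxA Bf -mulmxA pfj mulmx0.
have zs : ps *m (B *m pj) = 0 by rewrite mulmxA Bs -mulmxA psj mulmx0.
have rowf : pf *m ((B + Dl m) *m (pj + u m)) =
    pf *m (u m.+1 *m (B *m pj + block_drift u m)).
  have h : pf *m (B *m u m) = pf *m (u m.+1 *m B + remainder u m).
    rewrite mulmxA Bf -mulmxA fixf /fast_part Gf !mulmxA BGf -mulmxA.
    by rewrite mulmxDl errj -(mulmxA (u m.+1)) Bu.
  rewrite mulmxDl err_eq [B *m (_ + _)]mulmxDr !mulmxDr mulmxN zf Bu h mulmxDr.
  by mx_abel.
have rows : ps *m ((B + Dl m) *m (pj + u m)) =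
    ps *m (u m.+1 *m (B *m pj + block_drift u m)).
  case: GBj => [->|GB]; first by rewrite !mul0mx.
  have h : ps *m (u m.+1 *m B) = ps *m (B *m u m - remainder u m).
    rewrite mulmxA fixs /slow_part -[_ *m G *m pj]mulmxA -mulmxA GB -mulmxA.
    by rewrite mulmxBl errj -(mulmxA B) uj.
  rewrite mulmxDl err_eq [B *m (_ + _)]mulmxDr !mulmxDr mulmxN zs Bu h.
  by rewrite mulmxDr mulmxN; mx_abel.
have rowj : pj *m ((B + Dl m) *m (pj + u m)) = B *m pj + block_drift u m.
  rewrite mulmxDl [B *m (_ + _)]mulmxDr !mulmxDr.
  rewrite [pj *m (B *m pj)]mulmxA Bj -(mulmxA B) pjj.
  by rewrite [pj *m (B *m u m)]mulmxA Bj -(mulmxA B) ju mulmx0 addr0 /block_drift mulmxDr !mulmxA.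
have p3 X : X = pf *m X + pj *m X + ps *m X.
  by rewrite -!mulmxDl p_sum mul1mx.
rewrite [LHS]p3 rowf rowj rows -/(block_drift u m) (mulmxDl pj (u m.+1)).
rewrite [u m.+1 *m _ in RHS]p3.
have -> : pj *m (u m.+1 *m (B *m pj + block_drift u m)) = 0 by rewrite mulmxA ju' mul0mx.
have -> : pj *m (B *m pj + block_drift u m) = B *m pj + block_drift u m.
  by rewrite mulmxDr mulmxA Bj -mulmxA pjj /block_drift !mulmxA pjj.
by move: (B *m pj + _) => Z; rewrite addr0 [RHS]addrA (addrC Z).
Qed.

End InvariantColumn.

(** * Spectral projections of a complex matrix *)

Section GeneralizedEigenprojections.
Variable C : fieldType.

Lemma dvdp_prod_coprime (I : eqType) (s : seq I) (f : I -> {poly C}) p :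
  uniq s -> {in s &, forall a b, a != b -> coprimep (f a) (f b)} ->
  {in s, forall a, f a %| p} -> \prod_(a <- s) f a %| p.
Proof.
elim: s => [|a s ih] /=; first by rewrite big_nil dvd1p.
move=> /andP[a_s us] cop dv; rewrite big_cons Gauss_dvdp.
  rewrite dv ?mem_head//=; apply: ih => // [x y xs ys|x xs].
    by apply: cop; rewrite in_cons ?xs ?ys orbT.
  by apply: dv; rewrite in_cons xs orbT.
rewrite big_seq; apply: (big_ind (fun h => coprimep (f a) h)).
- exact: coprimep1.
- by move=> x y hx hy; rewrite coprimepMr hx hy.
- move=> x xs; apply: cop; rewrite ?mem_head ?in_cons ?xs ?orbT//.
  by apply: contraNneq a_s => ->.
Qed.

(** Bezout coefficients for the pairwise coprime factors ['X - mu] of a power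
    of the characteristic polynomial give the projections as polynomials in
    the matrix, so that they commute with it. *)
Lemma generalized_eigenprojections ell (B : 'M[C]_ell) (r : seq C) :
  char_poly B = \prod_(mu <- r) ('X - mu%:P) ->
  exists Pi : C -> 'M[C]_ell,
  [/\ \sum_(mu <- undup r) Pi mu = 1%:M,
      {in r, forall mu, (B - mu%:M) ^+ ell *m Pi mu = 0},
      {in r, forall mu (x : 'cV[C]_ell), (B - mu%:M) ^+ ell *m x = 0 ->
        Pi mu *m x = x /\ {in r, forall mu', mu' != mu -> Pi mu' *m x = 0}} &
      forall mu, Pi mu *m B = B *m Pi mu].
Proof.
case: ell B => [|n] B Br.
  exists (fun=> 0); split=> [|mu _|mu _ x _|mu]; try exact: etrans (flatmx0 _) (esym (flatmx0 _)).
  by split=> [|mu' _ _]; exact: etrans (flatmx0 _) (esym (flatmx0 _)).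
pose ell := n.+1; pose q mu : {poly C} := ('X - mu%:P) ^+ ell.
pose f mu := \prod_(nu <- undup r | nu != mu) q nu.
have qE mu : horner_mx B (q mu) = (B - mu%:M) ^+ ell.
  by rewrite rmorphXn rmorphB /= horner_mx_X horner_mx_C.
have cop mu nu : mu != nu -> coprimep (q mu) (q nu).
  move=> ne; apply/coprimep_expl/coprimep_expr.
  by rewrite coprimep_XsubC root_XsubC eq_sym.
have copf mu : coprimep (q mu) (f mu).
  apply: (big_ind (fun h => coprimep (q mu) h)); first exact: coprimep1.
    by move=> x y hx hy; rewrite coprimepMr hx hy.
  by move=> nu ne; apply: cop; rewrite eq_sym.
have bz mu : exists u : {poly C} * {poly C}, u.1 * q mu + u.2 * f mu = 1.
  by case/Bezout_eq1_coprimepP: (copf mu) => u; exists u.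
have [b bez] : exists b : C -> {poly C} * {poly C},
    forall mu, (b mu).1 * q mu + (b mu).2 * f mu = 1.
  by exists (fun mu => sval (cid (bz mu))) => mu; exact: (svalP (cid (bz mu))).
pose e mu := (b mu).2 * f mu.
have eE mu : e mu = 1 - (b mu).1 * q mu.
  by apply/eqP; rewrite eq_sym subr_eq addrC; apply/eqP/esym/bez.
have qf mu : mu \in r -> \prod_(nu <- undup r) q nu = q mu * f mu.
  by move=> mur; rewrite (bigD1_seq mu) ?mem_undup ?undup_uniq.
have dvd_f mu nu : nu \in r -> nu != mu -> q nu %| f mu.
  move=> nur ne; rewrite /f big_mkcond (bigD1_seq nu) ?mem_undup ?undup_uniq//=.
  by rewrite ne dvdp_mulr.
have dvdB p : (forall mu, mu \in r -> q mu %| p) -> horner_mx B p = 0.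
  move=> dv; have : char_poly B %| p.
    rewrite Br; apply: (@dvdp_trans _ (\prod_(nu <- undup r) q nu)).
      have -> : \prod_(mu <- r) ('X - mu%:P) =
          \prod_(mu <- undup r) ('X - mu%:P) ^+ count_mem mu r.
        by rewrite prodr_undup_exp_count.
      have szr : size r = ell.
        have := size_char_poly B; rewrite Br size_prod_XsubC => /eqP.
        by rewrite eqSS => /eqP.
      apply: (big_ind2 (fun h h' => h %| h')) => [|h1 h2 h3 h4|mu _]; first exact: dvdpp.
        exact: dvdp_mul.
      by apply: dvdp_exp2l; rewrite -szr count_size.
    apply: dvdp_prod_coprime; [exact: undup_uniq|by move=> x y _ _; exact: cop|].
    by move=> a; rewrite mem_undup; exact: dv.
  by move=> /dvdpP[h ->]; rewrite rmorphM /= Cayley_Hamilton mulr0.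
exists (fun mu => horner_mx B (e mu)); split.
- rewrite -rmorph_sum /= -[1%:M](rmorph1 (horner_mx B)).
  apply/eqP; rewrite -subr_eq0 -rmorphB; apply/eqP/dvdB => mu mur.
  rewrite (bigD1_seq mu) ?mem_undup ?undup_uniq//= {1}eE.
  rewrite addrAC [1 - _]addrC addrK dvdp_add ?dvdpNr ?dvdp_mull//.
  apply: (big_ind (fun h => q mu %| h)) => [|x y|nu ne].
  - exact: dvdp0.
  - exact: dvdp_add.
  by rewrite /e dvdp_mull// dvd_f// eq_sym.
- move=> mu mur; rewrite -qE -[_ *m _]rmorphM; apply: dvdB => nu nur.
  have [->|ne] := eqVneq nu mu; first by rewrite dvdp_mulr.
  by rewrite /e mulrCA dvdp_mull// dvdp_mull// dvd_f.
- move=> mu mur x; rewrite -qE => x0; split.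
    by rewrite eE rmorphB rmorph1 rmorphM mulmxBl mul1mx -mulmxA x0 mulmx0 subr0.
  move=> nu nur ne; have /dvdpP[h fE] : q mu %| f nu by rewrite dvd_f// eq_sym.
  by rewrite /e fE mulrA rmorphM /= -mulmxA x0 mulmx0.
- by move=> mu; apply: comm_horner_mx.
Qed.

End GeneralizedEigenprojections.

Section GrowthRates.
Variables (R : realType) (ell : nat) (B : 'M[R[i]]_ell).
Local Notation n := (nexp B).

Lemma logabs_neq0 (mu : R[i]) : mu != 0 -> logabs mu = (ln (cabs mu))%:E.
Proof.
move=> mu0; rewrite /logabs /= leNgt lt0r cabs_ge0 andbT.
by have -> // : cabs mu != 0; apply: contra_neq mu0 => /cabs_eq0.
Qed.

Lemma expeR_logabs (mu : R[i]) : expeR (logabs mu) = (cabs mu)%:E.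
Proof. by apply/eqP; rewrite lneK_eq lee_fin cabs_ge0. Qed.

Lemma exponentsP e : reflect (exists2 mu, mu \in spectrum B & mu != 0 /\ e = logabs mu)
  (e \in exponents B).
Proof.
rewrite mem_sort mem_undup; apply: (iffP mapP) => [[mu]|[mu muB [mu0 ->]]].
  by rewrite mem_filter => /andP[mu0 muB] ->; exists mu.
by exists mu; rewrite // mem_filter mu0.
Qed.

Lemma chi_last : chi B n = -oo%E.
Proof. by rewrite /chi nth_default. Qed.

Lemma chi_fin j : (j < n)%N -> exists2 mu, mu \in spectrum B &
  mu != 0 /\ chi B j = logabs mu.
Proof. by move=> jn; apply/exponentsP/mem_nth. Qed.

Lemma chi_gtNy j : (j < n)%N -> (-oo < chi B j)%E.
Proof. by move=> /chi_fin[mu _ [mu0 ->]]; rewrite logabs_neq0// ltNyr. Qed.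

Lemma chi_lty j : (chi B j < +oo)%E.
Proof.
have [jn|nj] := ltnP j n; last by rewrite /chi nth_default.
by have [mu _ [mu0 ->]] := chi_fin jn; rewrite logabs_neq0// ltry.
Qed.

Lemma chi_lt j k : (j < k)%N -> (k <= n)%N -> (chi B k < chi B j)%E.
Proof.
move=> jk; rewrite leq_eqVlt => /predU1P[kn|kn].
  by rewrite kn chi_last; apply: chi_gtNy; rewrite -kn.
have jn := ltn_trans jk kn.
have srt : sorted >=%O (exponents B) by apply/sort_sorted/ge_total.
rewrite lt_neqAle; apply/andP; split; last first.
  exact: (sorted_ltn_nth ge_trans _ srt).
rewrite /chi nth_uniq// ?sort_uniq ?undup_uniq//.
by rewrite neq_ltn jk orbT.
Qed.

(** The modulus of the eigenvalues of the [j]-th class; it is [0] for the last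
    class, which belongs to the eigenvalue [0]. *)
Definition rate (j : nat) : R := fine (expeR (chi B j)).

Lemma expeR_chi j : expeR (chi B j) = (rate j)%:E.
Proof.
have := chi_lty j; rewrite /rate; case: (chi B j) => [r| |]//=.
Qed.

Lemma rate_ge0 j : 0 <= rate j.
Proof. by rewrite -lee_fin -expeR_chi expeR_ge0. Qed.

Lemma rate_gt0 j : (j < n)%N -> 0 < rate j.
Proof. by move=> jn; rewrite -lte_fin -expeR_chi expeR_gt0// chi_gtNy. Qed.

Lemma rate_last : rate n = 0.
Proof. by rewrite /rate chi_last. Qed.

Lemma rate_lt j k : (j < k)%N -> (k <= n)%N -> rate k < rate j.
Proof.
by move=> jk kn; rewrite -lte_fin -!expeR_chi lte_expeR chi_lt.
Qed.

Lemma cabs_rate mu j : logabs mu = chi B j -> cabs mu = rate j.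
Proof. by move=> muj; rewrite /rate -muj expeR_logabs. Qed.

Lemma logabs_chi mu : mu \in spectrum B -> exists j : 'I_n.+1, logabs mu = chi B j.
Proof.
move=> muB; have [->|mu0] := eqVneq mu 0.
  by exists ord_max; rewrite chi_last /logabs cabs0 /= lexx.
have e_in : logabs mu \in exponents B by apply/exponentsP; exists mu.
have lt_n : (index (logabs mu) (exponents B) < n.+1)%N.
  by rewrite ltnW// ltnS index_mem.
by exists (Ordinal lt_n); rewrite /chi nth_index.
Qed.

Lemma chi_inj (j k : 'I_n.+1) : chi B j = chi B k -> j = k.
Proof.
move=> jk; apply/val_inj/eqP; rewrite eqn_leq; apply/andP.
split; rewrite leqNgt; apply/negP => lt.
  by have := chi_lt lt (ltn_ord j); rewrite jk ltxx.
by have := chi_lt lt (ltn_ord k); rewrite jk ltxx.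
Qed.

Lemma exprate_chi j N : (j < n)%N -> exprate (chi B j) N = rate j ^+ N.
Proof.
move=> jn; rewrite /exprate /rate.
have := chi_gtNy jn; have := chi_lty j; case: (chi B j) => [r| |]//= _ _.
by rewrite mulrC expRM_natl.
Qed.

Lemma expeR_chiB j k : (j < n)%N ->
  fine (expeR (chi B k - chi B j)%E) = rate k / rate j.
Proof.
move=> jn; rewrite /rate.
have := chi_gtNy jn; have := chi_lty j; have := chi_lty k.
case: (chi B j) (chi B k) => [r| |]// [s| |]//= _ _ _; last by rewrite mul0r.
by rewrite expRD expRN.
Qed.

End GrowthRates.

Section SpectralProjections.
Variables (R : realType) (ell : nat) (B : 'M[R[i]]_ell).
Variable P : 'I_(nexp B).+1 -> 'M[R[i]]_ell.
Hypothesis hP : spectral_projections P.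
Local Notation V := 'cV[R[i]]_ell.
Implicit Types (x : V) (j k : 'I_(nexp B).+1).

Lemma mem_lker_mxend (M : 'M[R[i]]_ell) x : (x \in lker (mxend M)) = (M *m x == 0).
Proof. by rewrite memv_ker lfunE. Qed.

Lemma gen_eigenspace_eq0 (mu : R[i]) x :
  x \in gen_eigenspace B mu -> (B - mu%:M) ^+ ell *m x = 0.
Proof. by move=> xE; apply/eqP; rewrite -mem_lker_mxend. Qed.

Lemma mem_Espace j x : (x \in Espace B j) = (P j *m x == x).
Proof.
case: hP => -[idem _] /(_ j) <-; apply/memv_imgP/eqP => [[y _ ->]|Px].
  by rewrite lfunE /= mulmxA idem.
by exists x; rewrite ?memvf// lfunE /= Px.
Qed.

Variable Pi : R[i] -> 'M[R[i]]_ell.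
Local Notation s := (spectrum B).
Hypothesis Pi_sum : \sum_(mu <- s) Pi mu = 1%:M.
Hypothesis Pi_nil : {in s, forall mu, (B - mu%:M) ^+ ell *m Pi mu = 0}.
Hypothesis Pi_id : {in s, forall mu x, (B - mu%:M) ^+ ell *m x = 0 ->
  Pi mu *m x = x /\ {in s, forall mu', mu' != mu -> Pi mu' *m x = 0}}.
Hypothesis Pi_comm : forall mu, Pi mu *m B = B *m Pi mu.

Let cls j (mu : R[i]) := logabs mu == chi B j.

Lemma Pi_Espace k x : x \in Espace B k ->
  {in s, forall mu, ~~ cls k mu -> Pi mu *m x = 0}.
Proof.
move=> xE mu mus muk; suff : (Espace B k <= lker (mxend (Pi mu)))%VS.
  by move/subvP/(_ _ xE); rewrite mem_lker_mxend => /eqP.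
rewrite /Espace big_seq_cond; apply: (big_ind (fun W => W <= _)%VS).
- exact: sub0v.
- by move=> U W hU hW; rewrite subv_add hU hW.
move=> nu /andP[nus nuk]; apply/subvP => y.
move=> /gen_eigenspace_eq0/(Pi_id nus)[_ /(_ _ mus) h].
have y0 : Pi mu *m y = 0.
  by apply: h; apply: contraNneq muk => ->.
by have := mem_lker_mxend (Pi mu) y; rewrite y0 eqxx.
Qed.

(** The right-hand side is the identity on the [j]-th subspace and kills the
    others, and every vector is the sum of its components [P k *m x]. Hence the
    given projections are polynomials in [B]. *)
Lemma spectral_projection_sum j : P j = \sum_(mu <- s | cls j mu) Pi mu.
Proof.
case: (hP) => -[_ sumP] _; have PE k x : P k *m x \in Espace B k.
  by case: hP => -[idem _] _; rewrite mem_Espace mulmxA idem.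
pose Q j := \sum_(mu <- s | cls j mu) Pi mu.
have Q0 k i x : i != k -> x \in Espace B k -> Q i *m x = 0.
  move=> ik xE; rewrite mulmx_suml big_seq_cond big1// => mu /andP[mus mui].
  apply: (Pi_Espace xE) => //; apply: contraNN ik => muk.
  by apply/eqP/chi_inj; rewrite -(eqP mui) (eqP muk).
have Q1 k x : x \in Espace B k -> Q k *m x = x.
  move=> xE; rewrite -[RHS]mul1mx -Pi_sum !mulmx_suml big_mkcond/=.
  apply: eq_big_seq => mu mus; case: ifP => // /negbT muk.
  by rewrite (Pi_Espace xE).
rewrite -/(Q j); apply: mulmx_col_inj => x.
have xE : x = \sum_k P k *m x by rewrite -mulmx_suml sumP mul1mx.
rewrite [x in RHS]xE mulmx_sumr (bigD1 j)//= (Q1 _ _ (PE _ _)) big1 ?addr0// => k kj.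
by rewrite (Q0 k)// eq_sym.
Qed.

End SpectralProjections.

(** * Norms adapted to the spectral splitting *)

Section AdaptedNorm.
Variables (R : realType) (ell : nat) (B : 'M[R[i]]_ell).
Variable P : 'I_(nexp B).+1 -> 'M[R[i]]_ell.
Hypothesis hP : spectral_projections P.
Local Notation V := 'cV[R[i]]_ell.
Local Notation mx := 'M[R[i]]_ell.
Implicit Types (x y : V) (j k : 'I_(nexp B).+1).
Local Notation s := (spectrum B).

Section WithEigenprojections.
Variable Pi : R[i] -> mx.
Hypothesis Pi_sum : \sum_(mu <- s) Pi mu = 1%:M.
Hypothesis Pi_nil : {in s, forall mu, (B - mu%:M) ^+ ell *m Pi mu = 0}.
Hypothesis Pi_id : {in s, forall mu x, (B - mu%:M) ^+ ell *m x = 0 ->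
  Pi mu *m x = x /\ {in s, forall mu', mu' != mu -> Pi mu' *m x = 0}}.
Hypothesis Pi_comm : forall mu, Pi mu *m B = B *m Pi mu.

Let cls j (mu : R[i]) := logabs mu == chi B j.

Lemma expmxS_col (M : mx) i x : M ^+ i.+1 *m x = M *m (M ^+ i *m x).
Proof. by rewrite exprS mulmxA. Qed.

Let PiPi mu nu : mu \in s -> nu \in s ->
  Pi mu *m Pi nu = if mu == nu then Pi nu else 0.
Proof.
move=> mus nus; apply: mulmx_col_inj => x.
have h : (B - nu%:M) ^+ ell *m (Pi nu *m x) = 0.
  by rewrite mulmxA Pi_nil// mul0mx.
have [h1 h2] := Pi_id nus h; rewrite -mulmxA.
have [->|ne] := eqVneq mu nu; first by rewrite h1.
by rewrite (h2 _ mus ne) mul0mx.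
Qed.

Let PiP mu j : mu \in s -> Pi mu *m P j = if cls j mu then Pi mu else 0.
Proof.
move=> mus; rewrite (spectral_projection_sum hP Pi_sum Pi_id) mulmx_sumr.
rewrite big_mkcond (bigD1_seq mu) ?undup_uniq//= PiPi// eqxx.
rewrite big_seq_cond big1 ?addr0// => nu /andP[nus ne].
by case: ifP => // _; rewrite PiPi// eq_sym (negbTE ne).
Qed.

(** The Jordan-Chevalley parts of [B]. *)
Variables semis nilp : mx.
Hypothesis semisE : semis = \sum_(mu <- s) mu *: Pi mu.
Hypothesis nilpE : nilp = B - semis.

Let semisPi mu : mu \in s -> semis *m Pi mu = mu *: Pi mu.
Proof.
move=> mus; rewrite semisE mulmx_suml (bigD1_seq mu) ?undup_uniq//= -scalemxAl PiPi// eqxx.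
rewrite big_seq_cond big1 ?addr0// => nu /andP[nus ne].
by rewrite -scalemxAl PiPi// (negbTE ne) scaler0.
Qed.

Let Pisemis mu : mu \in s -> Pi mu *m semis = mu *: Pi mu.
Proof.
move=> mus; rewrite semisE mulmx_sumr (bigD1_seq mu) ?undup_uniq//= -scalemxAr PiPi// eqxx.
rewrite big_seq_cond big1 ?addr0// => nu /andP[nus ne].
by rewrite -scalemxAr PiPi// eq_sym (negbTE ne) scaler0.
Qed.

Let semis_comm : semis *m B = B *m semis.
Proof.
rewrite semisE mulmx_suml mulmx_sumr; apply: eq_bigr => mu _.
by rewrite -scalemxAl -scalemxAr Pi_comm.
Qed.

Let nilp_semis : GRing.comm nilp semis.
Proof. by rewrite nilpE; apply/commr_sym/commrB; first exact: semis_comm. Qed.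

Let nilp_Pi mu : mu \in s -> GRing.comm nilp (Pi mu).
Proof.
move=> mus; rewrite nilpE; apply/commr_sym/commrB; first exact: Pi_comm.
by rewrite /GRing.comm -mulmxE Pisemis ?semisPi.
Qed.

Let nilpX_Pi i mu : mu \in s -> nilp ^+ i *m Pi mu = (B - mu%:M) ^+ i *m Pi mu.
Proof.
move=> mus; elim: i => [|i ih]; first by rewrite !expr0.
have NPi : nilp *m Pi mu = (B - mu%:M) *m Pi mu.
  by rewrite nilpE mulmxBl semisPi// mulmxBl mul_scalar_mx.
have comm_Pi : (B - mu%:M) *m Pi mu = Pi mu *m (B - mu%:M).
  by rewrite mulmxBl mulmxBr Pi_comm scalar_mxC.
rewrite !exprSr -!mulmxE -mulmxA NPi comm_Pi mulmxA ih -mulmxA -comm_Pi.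
by rewrite mulmxA.
Qed.

Let nilpX0 : nilp ^+ ell = 0.
Proof.
rewrite -(mulmx1 (nilp ^+ ell)) -Pi_sum mulmx_sumr big_seq big1// => mu mus.
by rewrite nilpX_Pi// Pi_nil.
Qed.

Variable eps : R.
Hypothesis eps0 : 0 < eps.

Let w mu i x : R := l1norm (Pi mu *m (nilp ^+ i *m x)).
(** Weighting the powers of the nilpotent part by [eps ^- i] makes its norm at
    most [eps]; the [l^1] sum over the eigenvalues makes the semisimple part
    dilate each spectral subspace exactly by its modulus. *)
Let nu x : R := \sum_(i < ell.+1) eps ^- i * \sum_(mu <- s) w mu i x.

Let w_ge0 mu i x : 0 <= w mu i x.
Proof. exact: (cnorm_ge0 (@is_cnorm_l1norm R ell)). Qed.

Let epsi0 i : 0 <= eps ^- i. Proof. by rewrite invr_ge0 exprn_ge0// ltW. Qed.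

Let is_cnorm_nu : is_cnorm nu.
Proof.
have l1 := @is_cnorm_l1norm R ell; split=> [x y|a x|x].
- rewrite /nu -big_split; apply: ler_sum => i _ /=.
  rewrite -mulrDr ler_wpM2l// -big_split; apply: ler_sum => mu _ /=.
  by rewrite /w !mulmxDr (cnormD l1).
- rewrite /nu mulr_sumr; apply: eq_bigr => i _; rewrite mulrCA; congr (_ * _).
  rewrite mulr_sumr; apply: eq_bigr => mu _.
  by rewrite /w -!scalemxAr (cnormZ l1).
- rewrite /nu => /eqP; rewrite psumr_eq0 => [|i _]; last first.
    by rewrite mulr_ge0// sumr_ge0.
  move/allP/(_ ord0); rewrite mem_index_enum => /(_ isT)/=.
  rewrite expr0 invr1 mul1r psumr_eq0// => /allP h.
  rewrite -[x]mul1mx -Pi_sum mulmx_suml big_seq big1// => mu mus.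
  by have /eqP/(cnorm_eq0 l1) := h _ mus; rewrite mul1mx.
Qed.

Let w_P mu i j x : mu \in s -> w mu i (P j *m x) = if cls j mu then w mu i x else 0.
Proof.
move=> mus; have e y : Pi mu *m (nilp ^+ i *m y) = nilp ^+ i *m (Pi mu *m y).
  rewrite !mulmxA; congr (_ *m _); apply/commrX/commr_sym; exact: nilp_Pi.
rewrite /w !e [Pi mu *m (P j *m x)]mulmxA PiP//; case: ifP => // _.
by rewrite mul0mx mulmx0 (cnorm0 (@is_cnorm_l1norm R ell)).
Qed.

Let nu_sum x : nu x = \sum_j nu (P j *m x).
Proof.
rewrite /nu [RHS]exchange_big; apply: eq_bigr => i _ /=; rewrite -mulr_sumr.
congr (_ * _); rewrite [RHS]exchange_big; apply: eq_big_seq => mu mus /=.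
have [j muj] := logabs_chi mus.
rewrite (bigD1 j)//= w_P// /cls muj eqxx big1 ?addr0// => k kj.
rewrite w_P//; case: ifP => // /eqP muk; case/eqP: kj; apply: chi_inj.
by rewrite -muk.
Qed.

Let nu_nilp x : nu (nilp *m x) <= eps * nu x.
Proof.
pose W i := \sum_(mu <- s) w mu i x.
have W0 i : 0 <= W i by apply: sumr_ge0.
have shift i : \sum_(mu <- s) w mu i (nilp *m x) = W i.+1.
  by apply: eq_bigr => mu _; rewrite /w exprSr -mulmxE -[_ *m nilp *m x]mulmxA.
have -> : nu (nilp *m x) = \sum_(i < ell) eps ^- i * W i.+1.
  rewrite /nu big_ord_recr /= shift.
  have -> : W ell.+1 = 0.
    rewrite /W big1// => mu _; rewrite /w exprSr nilpX0 mul0r mul0mx mulmx0.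
    exact: (cnorm0 (@is_cnorm_l1norm R ell)).
  by rewrite mulr0 addr0; apply: eq_bigr => i _; rewrite shift.
rewrite /nu big_ord_recl mulrDr -[X in X <= _]add0r lerD//.
  by apply: mulr_ge0; [exact: ltW|apply: mulr_ge0 => //; exact: W0].
rewrite mulr_sumr; apply: ler_sum => i _; rewrite mulrA exprS invfM mulVKf//.
by rewrite gt_eqF.
Qed.

Let nu_semis j x : P j *m x = x -> nu (semis *m x) = rate B j * nu x.
Proof.
move=> Px; rewrite /nu mulr_sumr; apply: eq_bigr => i _; rewrite mulrCA.
congr (_ * _); rewrite mulr_sumr; apply: eq_big_seq => mu mus.
have -> : w mu i (semis *m x) = cabs mu * w mu i x.
  rewrite /w -(cnormZ (@is_cnorm_l1norm R ell)); congr l1norm.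
  rewrite [nilp ^+ i *m _]mulmxA [nilp ^+ i *m semis](commr_sym (commrX i (commr_sym nilp_semis))).
  by rewrite -[_ * _]/(_ *m _) -[_ *m _ *m x]mulmxA mulmxA Pisemis// -scalemxAl.
rewrite -Px w_P//; case: ifP => [/eqP/cabs_rate -> //|_].
by rewrite !mulr0.
Qed.

Let nilp_diag : diagonalizable B -> nilp = 0.
Proof.
move=> [Q Qu /(similar_diagLR Qu)[d]]; rewrite conjVmx// => Bd.
rewrite -[nilp]mulmx1 -Pi_sum mulmx_sumr big_seq big1// => mu mus.
have := nilpX_Pi 1 mus; rewrite !expr1 => ->.
pose dm := diag_mx d - mu%:M.
have Bmu x : (B - mu%:M) *m x = invmx Q *m (dm *m (Q *m x)).
  rewrite /dm !mulmxBl mulmxBr !mul_scalar_mx -scalemxAr (mulKmx Qu).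
  by congr (_ - _); rewrite Bd -!mulmxA.
have dmxE y a : (dm *m y) a 0 = (d 0 a - mu) * y a 0.
  by rewrite /dm mulmxBl mul_diag_mx mul_scalar_mx !mxE mulrBl.
move: dm Bmu dmxE => dm Bmu dmxE.
have BmuX i x : (B - mu%:M) ^+ i *m x = invmx Q *m (dm ^+ i *m (Q *m x)).
  elim: i => [|i ih]; first by rewrite !expr0 !mul1mx (mulKmx Qu).
  apply: (etrans (expmxS_col _ i x)); apply: (etrans (congr1 (mulmx _) ih)).
  apply: (etrans (Bmu _)); congr (_ *m _).
  apply: (etrans _ (esym (expmxS_col dm i _))); congr (_ *m _).
  exact: (mulKVmx Qu).
have dmE i (y : V) a : (dm ^+ i *m y) a 0 = (d 0 a - mu) ^+ i * y a 0.
  elim: i => [|i ih]; first by rewrite !expr0 mul1mx mul1r.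
  by rewrite expmxS_col dmxE ih exprS mulrA.
apply: mulmx_col_inj => x; rewrite mul0mx -mulmxA Bmu.
move E : (Q *m (Pi mu *m x)) => y.
have y0 : dm ^+ ell *m y = 0.
  have := congr1 (fun M => Q *m (M *m x)) (Pi_nil mus).
  by rewrite /= mul0mx mulmx0 -mulmxA BmuX E (mulKVmx Qu).
suff -> : dm *m y = 0 by rewrite mulmx0.
apply/colP => a; rewrite dmxE mxE; apply/eqP.
have /colP/(_ a)/eqP := y0; rewrite dmE mxE !mulf_eq0.
by rewrite expf_eq0 => /orP[/andP[_ ->]//|->]; rewrite orbT.
Qed.

(** A nilpotent endomorphism of a line is zero. *)
Let nilp_dim1 j x : mult B j = 1%N -> P j *m x = x -> nilp *m x = 0.
Proof.
move=> dim1 Px; have [idem _] := hP.1.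
have nilpP (y : V) : P j *m (nilp *m y) = nilp *m (P j *m y).
  rewrite !mulmxA; congr (_ *m _).
  rewrite (spectral_projection_sum hP Pi_sum Pi_id) mulmx_suml mulmx_sumr.
  rewrite big_seq_cond [RHS]big_seq_cond; apply: eq_bigr => mu /andP[mus _].
  exact: esym (nilp_Pi mus).
have [->|x0] := eqVneq x 0; first by rewrite mulmx0.
have lineE : Espace B j = <[x]>%VS.
  apply/eqP; rewrite eq_sym eqEdim dim_vline x0 -[\dim _]/(mult B j) dim1 andbT.
  rewrite -memvE; have := mem_Espace hP j x; rewrite Px eqxx; exact.
have : nilp *m x \in Espace B j.
  have := mem_Espace hP j (nilp *m x); rewrite nilpP Px eqxx; exact.
rewrite lineE => /vlineP[c nx].
have nX i : nilp ^+ i *m x = c ^+ i *: x.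
  elim: i => [|i ih]; first by rewrite !expr0 mul1mx scale1r.
  by rewrite expmxS_col ih -scalemxAr nx scalerA -exprSr.
have := nX ell; rewrite nilpX0 mul0mx => /esym/eqP.
rewrite scaler_eq0 (negbTE x0) orbF expf_eq0 => /andP[_ /eqP c0].
by rewrite nx c0 scale0r.
Qed.

Lemma adapted_norm_of_resolution : exists nu' : V -> R, [/\ is_cnorm nu',
  forall x, nu' x = \sum_j nu' (P j *m x),
  forall j x, P j *m x = x ->
    (rate B j - eps) * nu' x <= nu' (B *m x) <= (rate B j + eps) * nu' x &
  forall j x, diagonalizable B \/ mult B j = 1%N -> P j *m x = x ->
    nu' (B *m x) = rate B j * nu' x].
Proof.
have BE x : B *m x = semis *m x + nilp *m x.
  by rewrite nilpE mulmxBl addrCA subrr addr0.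
exists nu; split=> // [j x Px|j x dj Px].
  rewrite BE; have := cnormD is_cnorm_nu (semis *m x) (nilp *m x).
  have := cnorm_subr is_cnorm_nu (semis *m x) (- (nilp *m x)).
  rewrite opprK (cnormN is_cnorm_nu) (nu_semis Px).
  have := nu_nilp x; rewrite mulrBl mulrDl => h1 h2 h3.
  apply/andP; split; first exact: le_trans (lerB (lexx _) h1) h2.
  exact: le_trans h3 (lerD (lexx _) h1).
have -> : B *m x = semis *m x.
  rewrite BE; case: dj => [/nilp_diag ->|/nilp_dim1 ->//]; last by rewrite addr0.
  by rewrite mul0mx addr0.
exact: nu_semis.
Qed.

End WithEigenprojections.

Lemma spectral_resolution : exists Pi : R[i] -> mx,
  [/\ \sum_(mu <- s) Pi mu = 1%:M,
      {in s, forall mu, (B - mu%:M) ^+ ell *m Pi mu = 0},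
      {in s, forall mu x, (B - mu%:M) ^+ ell *m x = 0 ->
        Pi mu *m x = x /\ {in s, forall mu', mu' != mu -> Pi mu' *m x = 0}} &
      forall mu, Pi mu *m B = B *m Pi mu].
Proof.
pose r := sval (closed_field_poly_normal (char_poly B)).
have Br : char_poly B = \prod_(mu <- r) ('X - mu%:P).
  have : char_poly B = lead_coef (char_poly B) *: \prod_(mu <- r) ('X - mu%:P).
    exact: (svalP (closed_field_poly_normal (char_poly B))).
  by rewrite (monicP (char_poly_monic B)) scale1r.
have sr mu : mu \in s -> mu \in r by rewrite mem_undup.
have [Pi [h1 h2 h3 h4]] := generalized_eigenprojections Br.
exists Pi; split=> // [mu /sr|mu /sr mur x /(h3 _ mur)[hx h]]; first exact: h2.
by split=> // mu' /sr; exact: h.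
Qed.

Lemma spectral_projection_mul j k : P j *m P k = if j == k then P j else 0.
Proof.
have [idem sumP] := hP.1.
have [Pi [h1 h2 h3 h4]] := spectral_resolution.
have [->|jk] := eqVneq j k; first exact: idem.
apply: mulmx_col_inj => x; rewrite mul0mx -mulmxA.
rewrite (spectral_projection_sum hP h1 h3 j) mulmx_suml big_seq_cond.
have PE : P k *m x \in Espace B k.
  by have := mem_Espace hP k (P k *m x); rewrite [P k *m (_ *m _)]mulmxA idem eqxx.
rewrite big1// => mu /andP[mus /eqP muj]; apply: (Pi_Espace h3 PE mus).
by apply: contraNN jk => /eqP muk; apply/eqP/chi_inj; rewrite -muj -muk.
Qed.

Lemma spectral_projection_comm j : P j *m B = B *m P j.
Proof.
have [Pi [h1 h2 h3 h4]] := spectral_resolution.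
rewrite (spectral_projection_sum hP h1 h3) mulmx_suml mulmx_sumr.
by apply: eq_bigr.
Qed.

Lemma adapted_norm (eps : R) : 0 < eps -> exists nu : V -> R, [/\ is_cnorm nu,
  forall x, nu x = \sum_j nu (P j *m x),
  forall j x, P j *m x = x ->
    (rate B j - eps) * nu x <= nu (B *m x) <= (rate B j + eps) * nu x &
  forall j x, diagonalizable B \/ mult B j = 1%N -> P j *m x = x ->
    nu (B *m x) = rate B j * nu x].
Proof.
have [Pi [h1 h2 h3 h4]] := spectral_resolution.
move=> eps0.
exact: (adapted_norm_of_resolution h1 h2 h3 h4 erefl erefl eps0).
Qed.

End AdaptedNorm.

(** * Block-diagonalization of a perturbed constant product *)

Section BlockDiagonalization.
Variables (R : realType) (ell n : nat) (B : 'M[R[i]]_ell).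
Variables (P : 'I_n.+1 -> 'M[R[i]]_ell) (nu : 'cV[R[i]]_ell -> R).
Local Notation V := 'cV[R[i]]_ell.
Local Notation mx := 'M[R[i]]_ell.
Local Notation opb := (opbound nu).
Implicit Types (x y : V) (j k : 'I_n.+1) (M : mx).
Hypothesis hnu : is_cnorm nu.
Hypothesis PP : forall j k, P j *m P k = if j == k then P j else 0.
Hypothesis sumP : \sum_j P j = 1%:M.
Hypothesis PB : forall j, P j *m B = B *m P j.

Lemma opbound_sum (I : Type) (r : seq I) (Q : pred I) (F : I -> mx) (c : I -> R) :
  (forall i, Q i -> opb (F i) (c i)) ->
  opb (\sum_(i <- r | Q i) F i) (\sum_(i <- r | Q i) c i).
Proof.
move=> Fc; apply: (big_ind2 (fun M e => opb M e)) => //.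
- exact: (opbound0 hnu).
- by move=> M1 e1 M2 e2; exact: (opboundD hnu).
Qed.

Lemma opbound_exists M : exists c, 0 <= c /\ opb M c.
Proof.
have [K [K0 hK]] := opbound_le_entries hnu.
have S0 : 0 <= \sum_i \sum_j cabs (M i j).
  by do 2 (apply: sumr_ge0 => ? _); exact: cabs_ge0.
exists (K * \sum_i \sum_j cabs (M i j)); split; first by rewrite mulr_ge0// ltW.
apply: hK => i j; rewrite (bigD1 i)//= (bigD1 j)//= -addrA lerDl addr_ge0//.
  by apply: sumr_ge0 => ? _; exact: cabs_ge0.
by do 2 (apply: sumr_ge0 => ? _); exact: cabs_ge0.
Qed.

Lemma unitmx_col_inj M : (forall x, M *m x = 0 -> x = 0) -> M \in unitmx.
Proof.
move=> inj; rewrite -unitmx_tr -row_free_unit; apply: inj_row_free => v vM.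
apply: trmx_inj; rewrite trmx0; apply: inj.
by rewrite -[M]trmxK -trmx_mul vM trmx0.
Qed.

Lemma sum_proj x : x = \sum_j P j *m x.
Proof. by rewrite -mulmx_suml sumP mul1mx. Qed.

Let psum (Q : pred 'I_n.+1) : mx := \sum_(k | Q k) P k.

Let P_psum j (Q : pred 'I_n.+1) : P j *m psum Q = if Q j then P j else 0.
Proof.
rewrite mulmx_sumr; case: ifP => Qj.
  rewrite (bigD1 j)//= PP eqxx big1 ?addr0// => k /andP[_ kj].
  by rewrite PP eq_sym (negbTE kj).
rewrite big1// => k Qk; rewrite PP; case: eqP => // jk.
by rewrite jk Qk in Qj.
Qed.

Let psum_P j (Q : pred 'I_n.+1) : psum Q *m P j = if Q j then P j else 0.
Proof.
rewrite mulmx_suml; case: ifP => Qj.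
  rewrite (bigD1 j)//= PP eqxx big1 ?addr0// => k /andP[_ kj].
  by rewrite PP (negbTE kj).
rewrite big1// => k Qk; rewrite PP; case: eqP => // jk.
by rewrite -jk Qk in Qj.
Qed.

Let psum_mul (Q Q' : pred 'I_n.+1) :
  psum Q *m psum Q' = \sum_(k | Q k && Q' k) P k.
Proof.
rewrite mulmx_suml [RHS]big_mkcondr; apply: eq_bigr => k _.
exact: P_psum.
Qed.

Let psum_idem Q : psum Q *m psum Q = psum Q.
Proof. by rewrite psum_mul; apply: eq_bigl => k; rewrite andbb. Qed.

Let psum_mul0 (Q Q' : pred 'I_n.+1) : (forall k, Q k && Q' k = false) ->
  psum Q *m psum Q' = 0.
Proof. by move=> QQ; rewrite psum_mul big_pred0. Qed.

Let psum_comm Q M : (forall j, P j *m M = M *m P j) -> psum Q *m M = M *m psum Q.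
Proof.
by move=> PM; rewrite mulmx_suml mulmx_sumr; apply: eq_bigr => k _; exact: PM.
Qed.

Hypothesis nu_sum : forall x, nu x = \sum_j nu (P j *m x).

Let nu_psum Q x : nu (psum Q *m x) = \sum_(k | Q k) nu (P k *m x).
Proof.
rewrite nu_sum [RHS]big_mkcond; apply: eq_bigr => k _ /=.
rewrite mulmxA P_psum; case: (Q k) => //.
by rewrite mul0mx (cnorm0 hnu).
Qed.

Let psum1 Q : opb (psum Q) 1.
Proof.
move=> x; rewrite mul1r nu_psum [leRHS]nu_sum big_mkcond; apply: ler_sum => k _ /=.
by case: (Q k) => //; exact: cnorm_ge0.
Qed.

Lemma opbound_proj j : opb (P j) 1.
Proof.
move=> x; rewrite mul1r [leRHS]nu_sum (bigD1 j)//= lerDl sumr_ge0// => k _.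
exact: cnorm_ge0.
Qed.

Variables (lo hi : 'I_n.+1 -> R) (kappa : R).
Hypothesis nu_lo : forall j x, P j *m x = x -> lo j * nu x <= nu (B *m x).
Hypothesis nu_hi : forall j x, P j *m x = x -> nu (B *m x) <= hi j * nu x.
Hypothesis hi0 : forall j, 0 < hi j.
Hypothesis kappa01 : 0 <= kappa < 1.
Hypothesis gap : forall j k, (j < k)%N -> hi k <= kappa * lo j.

Let PPx j x : P j *m (P j *m x) = P j *m x.
Proof. by rewrite mulmxA PP eqxx. Qed.

Let lo0 j : (j < n)%N -> 0 < lo j.
Proof.
move=> jn; have h : 0 < kappa * lo j by apply: lt_le_trans (gap (k := ord_max) jn).
by case/andP: kappa01 => k0 _; rewrite ltNge; apply: contraTN h => l0;
  rewrite -leNgt mulr_ge0_le0.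
Qed.

(** [B] may be singular on the last block only; replacing it there by the
    identity gives an invertible matrix that commutes with the projections. *)
Lemma block_inverse : exists G : mx, [/\ forall j, P j *m G = G *m P j,
  forall j, (j < n)%N -> G *m B *m P j = P j &
  forall j, (j < n)%N -> B *m G *m P j = P j].
Proof.
pose P0 := P ord_max; pose M := B *m (1%:M - P0) + P0.
have MP j : (j < n)%N -> M *m P j = B *m P j.
  move=> jn; have P0j : P0 *m P j = 0.
    by rewrite /P0 PP -val_eqE /= gtn_eqF.
  by rewrite /M mulmxDl -mulmxA mulmxBl mul1mx P0j subr0 addr0.
have MP0 : M *m P0 = P0.
  have P00 : P0 *m P0 = P0 by rewrite /P0 PP eqxx.
  by rewrite /M mulmxDl -mulmxA mulmxBl mul1mx P00 subrr mulmx0 add0r.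
have P0P j : P j *m P0 = P0 *m P j by rewrite /P0 !PP eq_sym; case: eqP => [->|].
have PM j : P j *m M = M *m P j.
  rewrite /M mulmxDr mulmxDl P0P mulmxA PB -!mulmxA; congr (_ *m _ + _).
  by rewrite mulmxBr mulmxBl P0P mulmx1 mul1mx.
clearbody M.
have Mu : M \in unitmx.
  apply: unitmx_col_inj => x Mx; rewrite (sum_proj x) big1// => j _.
  have MPx : M *m (P j *m x) = 0 by rewrite mulmxA -PM -mulmxA Mx mulmx0.
  have [jn|nj] := ltnP j n.
    have := nu_lo (PPx j x); rewrite [B *m (P j *m x)]mulmxA -MP// -mulmxA.
    rewrite MPx (cnorm0 hnu) pmulr_rle0 ?lo0// => le0.
    by apply: (cnorm_eq0 hnu); apply/eqP; rewrite eq_le le0 cnorm_ge0.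
  have -> : j = ord_max by apply: val_inj => /=; apply/eqP; rewrite eqn_leq nj -ltnS ltn_ord.
  by rewrite -/P0 -MP0 -[M *m P0](PM ord_max) -mulmxA Mx mulmx0.
have PG j : P j *m invmx M = invmx M *m P j.
  rewrite -[LHS]mul1mx -(mulVmx Mu) -!mulmxA; congr (_ *m _).
  by rewrite !mulmxA -PM -mulmxA mulmxV// mulmx1.
exists (invmx M); split=> // j jn.
  by rewrite -mulmxA -MP// mulmxA mulVmx// mul1mx.
by rewrite -mulmxA -PG mulmxA -MP// -PM -mulmxA mulmxV// mulmx1.
Qed.

Section WithInverse.
Variable G : mx.
Hypothesis PG : forall j, P j *m G = G *m P j.
Hypothesis GBP : forall j, (j < n)%N -> G *m B *m P j = P j.
Hypothesis BGP : forall j, (j < n)%N -> B *m G *m P j = P j.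

Let nuBP j x : nu (B *m P j *m x) <= hi j * nu x.
Proof.
rewrite -mulmxA; apply: (le_trans (nu_hi (PPx j x))).
by rewrite ler_wpM2l ?(ltW (hi0 j))// -[leRHS]mul1r; exact: opbound_proj.
Qed.

(** Conjugation by [B] contracts blocks sent backward into faster directions:
    [B^-1] shrinks them more than [B] expands the source. *)
Let backward_contraction j X c : 0 <= c -> opb (psum (fun k => k < j)%N *m X) c ->
  opb (psum (fun k => k < j)%N *m G *m X *m B *m P j) (kappa * c).
Proof.
move=> c0 Xc x; set pf := psum _ in Xc *.
have -> : pf *m G *m X *m B *m P j *m x = G *m (pf *m X *m (B *m P j *m x)).
  by rewrite (psum_comm _ PG) !mulmxA.
set z := pf *m X *m _.
have zc : nu z <= c * (hi j * nu x).
  by apply: (le_trans (Xc _)); rewrite ler_wpM2l ?nuBP.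
have Pz k : (j <= k)%N -> P k *m z = 0.
  by move=> jk; rewrite /z !mulmxA P_psum ltnNge jk !mul0mx.
have Gz : hi j * nu (G *m z) <= kappa * nu z.
  rewrite nu_sum [nu z]nu_sum !mulr_sumr; apply: ler_sum => k _.
  have -> : P k *m (G *m z) = G *m (P k *m z) by rewrite !mulmxA PG.
  have [jk|kj] := leqP j k; first by rewrite Pz// mulmx0 (cnorm0 hnu) !mulr0.
  have kn : (k < n)%N by apply: leq_trans kj _; rewrite -ltnS.
  have lok : lo k * nu (G *m (P k *m z)) <= nu (P k *m z).
    have PGz : P k *m (G *m (P k *m z)) = G *m (P k *m z).
      by rewrite [LHS]mulmxA PG -mulmxA PPx.
    by have := nu_lo PGz; rewrite !mulmxA BGP.
  apply: le_trans (_ : kappa * lo k * nu (G *m (P k *m z)) <= _).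
    by rewrite ler_wpM2r ?cnorm_ge0// gap.
  by rewrite -mulrA ler_wpM2l//; case/andP: kappa01.
rewrite -(ler_pM2l (hi0 j)); apply: (le_trans Gz).
by rewrite [leRHS]mulrCA -!mulrA ler_wpM2l//; case/andP: kappa01.
Qed.

(** Dually, blocks carried forward into slower directions are contracted. *)
Let forward_contraction j X c : 0 <= c -> opb (psum (fun k => j < k)%N *m X) c ->
  opb (psum (fun k => j < k)%N *m B *m X *m G *m P j) (kappa * c).
Proof.
move=> c0 Xc x; set ps := psum _ in Xc *.
have k0 : 0 <= kappa by case/andP: kappa01.
have -> : ps *m B *m X *m G *m P j *m x = B *m (ps *m X *m (G *m (P j *m x))).
  by rewrite (psum_comm _ PB) !mulmxA.
set z := ps *m X *m _.
have [nj|jn] := leqP n j.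
  have -> : z = 0.
    rewrite /z /ps /psum big_pred0 ?mul0mx// => k.
    by apply/negbTE; rewrite -leqNgt; apply: leq_trans nj; rewrite -ltnS.
  by rewrite mulmx0 (cnorm0 hnu) !mulr_ge0// cnorm_ge0.
have zc : nu z <= c * nu (G *m (P j *m x)) by exact: Xc.
have Pz k : (k <= j)%N -> P k *m z = 0.
  by move=> kj; rewrite /z !mulmxA P_psum ltnNge kj !mul0mx.
have Bz : nu (B *m z) <= kappa * lo j * nu z.
  rewrite nu_sum [nu z]nu_sum !mulr_sumr; apply: ler_sum => k _.
  have -> : P k *m (B *m z) = B *m (P k *m z) by rewrite !mulmxA PB.
  have [kj|jk] := leqP k j; first by rewrite Pz// mulmx0 (cnorm0 hnu) !mulr0.
  apply: (le_trans (nu_hi (PPx k z))).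
  by rewrite ler_wpM2r ?cnorm_ge0// gap.
apply: (le_trans Bz); rewrite -!mulrA ler_wpM2l//.
apply: le_trans (_ : lo j * (c * nu (G *m (P j *m x))) <= _).
  by rewrite ler_wpM2l// ltW// lo0.
rewrite mulrCA ler_wpM2l//.
have PGz : P j *m (G *m (P j *m x)) = G *m (P j *m x).
  by rewrite [LHS]mulmxA PG -mulmxA PPx.
apply: le_trans (nu_lo PGz) _; rewrite mulmxA [B *m G *m _]mulmxA BGP//.
by rewrite -[leRHS]mul1r; exact: opbound_proj.
Qed.

Let block_column g rho q eta Dl j : 0 <= g -> opb G g -> 0 < rho <= 1 ->
  0 < q < 1 -> 0 <= eta -> 24 * g * eta <= (1 - kappa) * rho ->
  (forall m, opb (Dl m) (eta * q ^+ m)) ->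
  exists u : nat -> mx, forall m,
  [/\ u m *m P j = u m /\ P j *m u m = 0,
      opb (u m) (2 * rho), forall k, (k < j)%N -> opb (P k *m u m) (rho * q ^+ m) &
      (B + Dl m) *m (P j + u m) =
      (P j + u m.+1) *m (B *m P j + P j *m Dl m *m (P j + u m))].
Proof.
move=> g0 Gg rho01 q01 eta0 small Dlm.
pose pf := psum (fun k => k < j)%N; pose ps := psum (fun k => j < k)%N.
have ltF (k : 'I_n.+1) : (k < j)%N && (j < k)%N = false.
  by apply/negbTE/negP => /andP[kj]; rewrite ltnNge (ltnW kj).
have psumE : pf + P j + ps = 1%:M.
  rewrite -sumP (bigID (fun k => k < j)%N)/= -addrA; congr (_ + _).
  rewrite (bigD1 j) ?ltnn//=; congr (_ + _); apply: eq_bigl => k.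
  by rewrite -leqNgt [(_ < _)%N]ltn_neqAle eq_sym andbC.
have jf : P j *m pf = 0 by rewrite P_psum ltnn.
have js : P j *m ps = 0 by rewrite P_psum ltnn.
have fj : pf *m P j = 0 by rewrite psum_P ltnn.
have sj : ps *m P j = 0 by rewrite psum_P ltnn.
have fs : pf *m ps = 0 by apply: psum_mul0.
have sf : ps *m pf = 0 by apply: psum_mul0 => k; rewrite andbC.
have BGf : B *m G *m pf = pf.
  rewrite mulmx_sumr; apply: eq_bigr => k kj.
  by apply: BGP; apply: leq_trans kj _; rewrite -ltnS.
have GBj : ps = 0 \/ G *m P j *m B = P j.
  have [nj|jn] := leqP n j; [left|right].
    rewrite /ps /psum big_pred0// => k.
    by apply/negbTE; rewrite -leqNgt; apply: leq_trans nj; rewrite -ltnS.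
  by rewrite -mulmxA PB mulmxA GBP.
have PPj : P j *m P j = P j by rewrite PP eqxx.
have [u hu] := invariant_column hnu psumE (psum_idem _) PPj (psum_idem _) fj fs jf js
  sf sj (psum_comm _ PB) (PB j) (psum_comm _ PB) (psum_comm _ PG) BGf GBj (psum1 _)
  (opbound_proj j) (psum1 _) Gg g0 kappa01 rho01 q01 eta0 small
  (@backward_contraction j) (@forward_contraction j) Dlm.
have /andP[rho0 rho1] := rho01; have /andP[q0 q1] := q01.
exists u => m; have [[uj ju] uf us eq] := hu m; split=> //.
  have -> : u m = pf *m u m + ps *m u m.
    by rewrite -[LHS]mul1mx -psumE !mulmxDl ju addr0.
  apply: (opbound_le hnu (opboundD hnu uf us)).
  have : rho * q ^+ m <= rho by rewrite ler_piMr ?(ltW rho0)// exprn_ile1// ltW.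
  by lra.
move=> k kj; have -> : P k *m u m = P k *m (pf *m u m).
  by rewrite mulmxA P_psum kj.
by rewrite -[_ * _]mul1r; apply: opboundM => //; exact: opbound_proj.
Qed.

Lemma block_diagonalization_of_inverse rho q : 0 < rho <= 1 -> 0 < q < 1 ->
  exists eta, 0 < eta /\ forall Dl : nat -> mx,
  (forall m, opb (Dl m) (eta * q ^+ m)) ->
  exists H D : nat -> mx, forall m,
  [/\ (B + Dl m) *m H m = H m.+1 *m D m, forall j, P j *m D m = D m *m P j,
      opb (D m - B) (rho * q ^+ m), opb (H m - 1%:M) rho &
      forall j k, (k < j)%N -> opb (P k *m H m *m P j) (rho * q ^+ m)].
Proof.
move=> /andP[rho0 rho1] q01; have [g [g0 Gg]] := opbound_exists G.
have /andP[q0 q1] := q01; have /andP[k0 k1] := kappa01.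
have N0 : 0 < n.+1%:R :> R by rewrite ltr0n.
have N1 : 1 <= n.+1%:R :> R by rewrite ler1n.
(* [H m - 1] is a sum of [n.+1] columns, each bounded by twice the radius *)
pose r := rho / (2 * n.+1%:R).
have r0 : 0 < r by rewrite divr_gt0// mulr_gt0.
have r1 : r <= rho by rewrite ler_pdivrMr ?mulr_gt0// ler_peMr ?(ltW rho0)//; lra.
have r01 : 0 < r <= 1 by rewrite r0 (le_trans r1).
have rN : n.+1%:R * (2 * r) = rho.
  by rewrite /r; field; rewrite ?gt_eqF.
pose eta := Num.min ((1 - kappa) * r / (24 * (g + 1))) (rho / (3 * n.+1%:R)).
have eta0 : 0 < eta.
  by rewrite lt_min !(divr_gt0, mulr_gt0)//; lra.
have small : 24 * g * eta <= (1 - kappa) * r.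
  have : eta <= (1 - kappa) * r / (24 * (g + 1)) by rewrite ge_min lexx.
  rewrite ler_pdivlMr; last lra.
  by apply: le_trans; nra.
have small' : n.+1%:R * (3 * eta) <= rho.
  have : eta <= rho / (3 * n.+1%:R) by rewrite ge_min lexx orbT.
  rewrite ler_pdivlMr ?mulr_gt0//.
  by have -> : n.+1%:R * (3 * eta) = eta * (3 * n.+1%:R) by ring.
exists eta; split=> // Dl Dlm.
have colE j := block_column j g0 Gg r01 q01 (ltW eta0) small Dlm.
have [u hu] : exists u : 'I_n.+1 -> nat -> mx, forall j m,
  [/\ u j m *m P j = u j m /\ P j *m u j m = 0,
      opb (u j m) (2 * r), forall k, (k < j)%N -> opb (P k *m u j m) (r * q ^+ m) &
      (B + Dl m) *m (P j + u j m) =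
      (P j + u j m.+1) *m (B *m P j + P j *m Dl m *m (P j + u j m))].
  by exists (fun j => sval (cid (colE j))) => j; exact: (svalP (cid (colE j))).
pose col j m := P j + u j m; pose D1 j m := P j *m Dl m *m col j m.
have colP j k m : col j m *m P k = if k == j then col j m else 0.
  have [[uj _] _ _ _] := hu j m; rewrite /col mulmxDl -[u j m]uj -mulmxA !PP.
  rewrite eq_sym; case: eqP => // _.
  by rewrite mulmx0 addr0.
pose H m := \sum_j col j m; pose D m := \sum_j (B *m P j + D1 j m).
have HP j m : H m *m P j = col j m.
  rewrite mulmx_suml (bigD1 j)//= colP eqxx big1 ?addr0// => k kj.
  by rewrite colP eq_sym (negbTE kj).
have PDj j m : P j *m (B *m P j + D1 j m) = B *m P j + D1 j m.
  by rewrite mulmxDr mulmxA PB -mulmxA PP eqxx /D1 !mulmxA PP eqxx.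
have DjP j k m : (B *m P j + D1 j m) *m P k = if k == j then B *m P j + D1 j m else 0.
  rewrite mulmxDl -mulmxA PP /D1 -mulmxA colP eq_sym.
  by case: eqP => //; rewrite !mulmx0 addr0.
have DP j m : D m *m P j = B *m P j + D1 j m.
  rewrite mulmx_suml (bigD1 j)//= DjP eqxx big1 ?addr0// => k kj.
  by rewrite DjP eq_sym (negbTE kj).
have PD j m : P j *m D m = B *m P j + D1 j m.
  rewrite mulmx_sumr (bigD1 j)//= PDj big1 ?addr0// => k kj.
  by rewrite -PDj mulmxA PP eq_sym (negbTE kj) mul0mx.
exists H, D => m; split.
- rewrite mulmx_sumr mulmx_sumr; apply: eq_bigr => j _.
  have [_ _ _ ->] := hu j m; rewrite -/(col j m) -/(D1 j m).
  by rewrite -[X in _ = H _ *m X]PDj [RHS]mulmxA HP.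
- by move=> j; rewrite DP PD.
- have -> : D m - B = \sum_j D1 j m.
    by rewrite /D big_split /= -mulmx_sumr sumP mulmx1 addrAC subrr add0r.
  have h j : opb (D1 j m) (3 * eta * q ^+ m).
    have [_ u2 _ _] := hu j m.
    have c3 : opb (col j m) 3.
      by apply: (opbound_le hnu (opboundD hnu (opbound_proj j) u2)); lra.
    have e0 : 0 <= eta * q ^+ m by rewrite mulr_ge0 ?exprn_ge0// ltW.
    rewrite /D1 -mulmxA.
    by apply: (opbound_le hnu (opboundM ler01 (opbound_proj j) (opboundM e0 (Dlm m) c3))); lra.
  apply: (opbound_le hnu (opbound_sum _ (fun j _ => h j))).
  rewrite sumr_const card_ord -[leLHS]mulr_natl mulrA ler_wpM2r// exprn_ge0//.
  exact: ltW.
- have -> : H m - 1%:M = \sum_j u j m.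
    by rewrite /H big_split /= sumP addrAC subrr add0r.
  have h j : opb (u j m) (2 * r) by have [] := hu j m.
  apply: (opbound_le hnu (opbound_sum _ (fun j _ => h j))).
  by rewrite sumr_const card_ord -[leLHS]mulr_natl rN.
- move=> j k kj; rewrite -mulmxA HP /col mulmxDr PP -val_eqE /= ltn_eqF// add0r.
  have [_ _ h _] := hu j m; apply: (opbound_le hnu (h k kj)).
  by rewrite ler_wpM2r// exprn_ge0// ltW.
Qed.

End WithInverse.

(** Summing the invariant columns over [j] gives [H m], and summing the blocks
    through which they are mapped gives [D m]. The threshold [eta] does not
    depend on [Dl], which makes the conclusion uniform over families [Dl]. *)
Lemma block_diagonalization rho q : 0 < rho <= 1 -> 0 < q < 1 ->
  exists eta, 0 < eta /\ forall Dl : nat -> mx,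
  (forall m, opb (Dl m) (eta * q ^+ m)) ->
  exists H D : nat -> mx, forall m,
  [/\ (B + Dl m) *m H m = H m.+1 *m D m, forall j, P j *m D m = D m *m P j,
      opb (D m - B) (rho * q ^+ m), opb (H m - 1%:M) rho &
      forall j k, (k < j)%N -> opb (P k *m H m *m P j) (rho * q ^+ m)].
Proof.
have [G [PG GBP BGP]] := block_inverse.
exact: (block_diagonalization_of_inverse PG GBP BGP).
Qed.

End BlockDiagonalization.

(** * Growth of products inside one block *)

Section ProductEstimates.
Variable R : realType.
Implicit Types (x : nat -> R) (m K q : R).

(** The factors [1 + (K / m) q^i] are at most [expR ((K / m) q^i)], and the
    exponents sum to at most [K / (m (1 - q))]. *)
Lemma growth_le m K q x : 0 < m -> 0 <= K -> 0 < q < 1 -> (forall i, 0 <= x i) ->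
  (forall i, x i.+1 <= (m + K * q ^+ i) * x i) ->
  forall N, x N <= expR (K / (m * (1 - q))) * m ^+ N * x 0%N.
Proof.
move=> m0 K0 /andP[q0 q1] x0 dx N.
have q1' : 0 < 1 - q by lra.
have : x N <= expR (K / (m * (1 - q)) * (1 - q ^+ N)) * m ^+ N * x 0%N.
  elim: N => [|N ih]; first by rewrite !expr0 subrr mulr0 expR0 !mul1r.
  have c0 : 0 <= m + K * q ^+ N by rewrite addr_ge0 ?mulr_ge0 ?exprn_ge0// ltW.
  apply: (le_trans (dx N)); apply: le_trans (ler_wpM2l c0 ih) _.
  have le1 : m + K * q ^+ N <= m * expR (K / m * q ^+ N).
    apply: le_trans (ler_wpM2l (ltW m0) (expR_ge1Dx _)).
    by rewrite mulrDr mulr1 mulrA [m * (K / m)]mulrC divfK ?gt_eqF.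
  set E := expR (_ * (1 - q ^+ N)).
  have -> : expR (K / (m * (1 - q)) * (1 - q ^+ N.+1)) = expR (K / m * q ^+ N) * E.
    rewrite /E -expRD; congr expR; rewrite exprS; field.
    by rewrite !gt_eqF.
  rewrite exprS !mulrA !ler_wpM2r// ?exprn_ge0 ?(ltW m0)//.
  by rewrite [_ * m]mulrC mulrA ler_wpM2r ?expR_ge0.
have c0 : 0 <= K / (m * (1 - q)) by rewrite divr_ge0 ?mulr_ge0 ?(ltW m0) ?(ltW q1').
move=> h; apply: (le_trans h); rewrite !ler_wpM2r ?exprn_ge0 ?(ltW m0)//.
by rewrite ler_expR ler_piMr// lerBlDr lerDl exprn_ge0// ltW.
Qed.

Lemma expRN_le (t : R) : 0 <= t <= 2^-1 -> expR (- (2 * t)) <= 1 - t.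
Proof.
move=> /andP[t0 t1]; rewrite expRN.
have h : 1 <= (1 - t) * (1 + 2 * t) by nra.
have e0 : 0 < expR (2 * t) by exact: expR_gt0.
rewrite -(ler_pM2r e0) mulVf ?gt_eqF//; apply: (le_trans h).
by rewrite ler_wpM2l ?expR_ge1Dx//; lra.
Qed.

(** The same with [1 - t >= expR (- 2 t)], valid for [0 <= t <= 1/2]. *)
Lemma growth_ge m K q x : 0 < m -> 0 <= K -> 2 * K <= m -> 0 < q < 1 ->
  (forall i, 0 <= x i) -> (forall i, (m - K * q ^+ i) * x i <= x i.+1) ->
  forall N, expR (- (2 * (K / (m * (1 - q))))) * m ^+ N * x 0%N <= x N.
Proof.
move=> m0 K0 Km /andP[q0 q1] x0 dx N.
have q1' : 0 < 1 - q by lra.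
have : expR (- (2 * (K / (m * (1 - q)))) * (1 - q ^+ N)) * m ^+ N * x 0%N <= x N.
  elim: N => [|N ih]; first by rewrite !expr0 subrr mulr0 expR0 !mul1r.
  have qN0 : 0 <= q ^+ N by rewrite exprn_ge0// ltW.
  have qN1 : q ^+ N <= 1 by rewrite exprn_ile1// ltW.
  have t01 : 0 <= K / m * q ^+ N <= 2^-1.
    apply/andP; split; first by rewrite mulr_ge0// divr_ge0// ltW.
    rewrite -[leRHS]mulr1; apply: ler_pM => //; first by rewrite divr_ge0// ltW.
    by rewrite ler_pdivrMr// ler_pdivlMl// mulrC; lra.
  have le1 : m * expR (- (2 * (K / m * q ^+ N))) <= m - K * q ^+ N.
    apply: (le_trans (ler_wpM2l (ltW m0) (expRN_le t01))).
    by rewrite mulrBr mulr1 mulrA [m * (K / m)]mulrC divfK ?gt_eqF.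
  have c0 : 0 <= m - K * q ^+ N.
    by apply: le_trans le1; rewrite mulr_ge0 ?expR_ge0 ?ltW.
  apply: le_trans (dx N); apply: (le_trans _ (ler_wpM2l c0 ih)).
  set E := expR (_ * (1 - q ^+ N)).
  have -> : expR (- (2 * (K / (m * (1 - q)))) * (1 - q ^+ N.+1)) =
      expR (- (2 * (K / m * q ^+ N))) * E.
    rewrite /E -expRD; congr expR; rewrite exprS; field.
    by rewrite !gt_eqF.
  set e := expR (- (2 * (K / m * q ^+ N))) in le1 *.
  rewrite exprS !mulrA !ler_wpM2r// ?exprn_ge0 ?(ltW m0)//.
  by rewrite [leLHS]mulrAC ler_wpM2r ?expR_ge0// mulrC.
have c0 : 0 <= K / (m * (1 - q)) by rewrite divr_ge0 ?mulr_ge0 ?(ltW m0) ?(ltW q1').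
apply: le_trans; rewrite !ler_wpM2r ?exprn_ge0 ?(ltW m0)//.
have c20 := mulr_ge0 (ler0n R 2) c0.
rewrite ler_expR mulNr lerN2 ler_piMr//.
by rewrite lerBlDr lerDl exprn_ge0// ltW.
Qed.

End ProductEstimates.

Section BlockProducts.
Variables (R : realType) (ell : nat) (B : 'M[R[i]]_ell).
Local Notation V := 'cV[R[i]]_ell.
Local Notation mx := 'M[R[i]]_ell.
Implicit Types (x y z : V) (D H : nat -> mx).

Fixpoint mxprod D N : mx := if N is N'.+1 then D N' *m mxprod D N' else 1%:M.

Lemma mxprod_comm (M : mx) D N : (forall m, M *m D m = D m *m M) ->
  M *m mxprod D N = mxprod D N *m M.
Proof.
move=> MD; elim: N => [|N ih] /=; first by rewrite mulmx1 mul1mx.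
by rewrite mulmxA MD -!mulmxA ih.
Qed.

Variables (nu : V -> R) (rho q : R) (pj : mx).
Hypothesis hnu : is_cnorm nu.
Hypothesis rho0 : 0 < rho.
Hypothesis q01 : 0 < q < 1.

Let near_block D := forall m,
  pj *m D m = D m *m pj /\ opbound nu (D m - B) (rho * q ^+ m).

Let fixed_prod D y N : near_block D -> pj *m y = y ->
  pj *m (mxprod D N *m y) = mxprod D N *m y.
Proof.
move=> hD yj; rewrite mulmxA mxprod_comm; first by rewrite -mulmxA yj.
by move=> m; case: (hD m).
Qed.

(** Bounds obtained in a norm [nu'] adapted to [B] are transported to [nu]
    with constants that do not depend on the product. *)
Lemma mxprod_le (nu' : V -> R) m : is_cnorm nu' -> 0 < m ->
  (forall x, pj *m x = x -> nu' (B *m x) <= m * nu' x) ->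
  exists C, 0 < C /\ forall D y N, near_block D -> pj *m y = y ->
    nu (mxprod D N *m y) <= C * m ^+ N * nu y.
Proof.
move=> hnu' m0 Bm.
have [K1 [K10 le1]] := cnorm_equiv hnu' hnu.
have [K2 [K20 le2]] := cnorm_equiv hnu hnu'.
pose K := K1 * rho * K2; have K0 : 0 < K by rewrite !mulr_gt0.
exists (K2 * expR (K / (m * (1 - q))) * K1); split.
  by rewrite !mulr_gt0// expR_gt0.
move=> D y N hD yj; pose x i := nu' (mxprod D i *m y).
have dx i : x i.+1 <= (m + K * q ^+ i) * x i.
  rewrite /x /= -mulmxA; move: (fixed_prod i hD yj).
  move: (mxprod D i *m y) => z zj; have [_ Di] := hD i.
  have -> : D i *m z = B *m z + (D i - B) *m z by rewrite -mulmxDl addrC subrK.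
  rewrite mulrDl (le_trans (cnormD hnu' _ _))// lerD ?Bm//.
  apply: (le_trans (le1 _)); rewrite /K -!mulrA ler_wpM2l ?(ltW K10)//.
  apply: (le_trans (Di _)); rewrite -!mulrA ler_wpM2l ?(ltW rho0)//.
  rewrite [leRHS]mulrCA ler_wpM2l ?exprn_ge0// ?(ltW (andP q01).1)//.
have := growth_le m0 (ltW K0) q01 (fun i => cnorm_ge0 hnu' _) dx N.
rewrite /x /= mul1mx => h; apply: (le_trans (le2 _)).
rewrite -!mulrA ler_wpM2l ?(ltW K20)//; apply: (le_trans h).
rewrite -!mulrA ler_wpM2l ?expR_ge0// [leRHS]mulrCA ler_wpM2l ?exprn_ge0 ?(ltW m0)//.
Qed.

(** The perturbation need not be small in [nu'], where the factors [D m] could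
    then shrink vectors at early times. From a time [i0] on it is small in [nu'];
    up to [i0] the bound [c0] in [nu] keeps the product bounded below. *)
Lemma mxprod_ge (nu' : V -> R) m c0 : is_cnorm nu' -> 0 < m ->
  (forall x, pj *m x = x -> m * nu' x <= nu' (B *m x)) ->
  2 * rho <= c0 -> (forall x, pj *m x = x -> c0 * nu x <= nu (B *m x)) ->
  exists C, 0 < C /\ exists N0 : nat,
    forall D y N, (N0 <= N)%N -> near_block D -> pj *m y = y ->
    m ^+ N * nu y <= C * nu (mxprod D N *m y).
Proof.
move=> hnu' m0 Bm c0rho Bc0; have /andP[q0 q1] := q01.
have [K1 [K10 le1]] := cnorm_equiv hnu' hnu.
have [K2 [K20 le2]] := cnorm_equiv hnu hnu'.
have nu0 := cnorm_ge0 hnu.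
pose K := K1 * rho * K2; have K0 : 0 < K by rewrite !mulr_gt0.
have q01' : 0 <= q < 1 by rewrite ltW.
have m20 : 0 < m / 2 by rewrite divr_gt0.
have [i0 hi0] := geometric_small (ltW K0) q01' m20.
have {}hi0 : 2 * (K * q ^+ i0) <= m by have := hi0 _ (leqnn i0); lra.
pose K' := K * q ^+ i0; have K'0 : 0 <= K' by rewrite mulr_ge0 ?exprn_ge0 ?ltW.
pose E := expR (- (2 * (K' / (m * (1 - q))))).
have E0 : 0 < E by exact: expR_gt0.
have r0 : 0 < rho ^+ i0 by rewrite exprn_gt0.
have mi0 : 0 < m ^+ i0 by rewrite exprn_gt0.
exists (m ^+ i0 * (K1 * K2) / (rho ^+ i0 * E)); split.
  by rewrite divr_gt0// !mulr_gt0.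
exists i0 => D y N iN hD yj.
have step1 z i : pj *m z = z -> rho * nu z <= nu (D i *m z).
  move=> zj; have [_ Di] := hD i.
  have -> : D i *m z = B *m z - (- ((D i - B) *m z)).
    by rewrite opprK -mulmxDl addrC subrK.
  apply: le_trans (cnorm_subr hnu _ _); rewrite (cnormN hnu) lerBrDr.
  apply: le_trans (Bc0 z zj); have := Di z.
  have : rho * q ^+ i * nu z <= rho * nu z.
    by rewrite ler_wpM2r// ler_piMr ?(ltW rho0)// exprn_ile1// ltW.
  have : 2 * rho * nu z <= c0 * nu z by rewrite ler_wpM2r.
  by lra.
have step2 i : rho ^+ i * nu y <= nu (mxprod D i *m y).
  elim: i => [|i ih]; first by rewrite expr0 mul1r mul1mx.
  rewrite exprS -mulrA /= -mulmxA.
  by apply: le_trans (step1 _ i (fixed_prod i hD yj)); rewrite ler_wpM2l ?(ltW rho0).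
pose x i := nu' (mxprod D (i + i0) *m y).
have dx i : (m - K' * q ^+ i) * x i <= x i.+1.
  rewrite /x /= -mulmxA; move: (fixed_prod (i + i0) hD yj).
  move: (mxprod D (i + i0) *m y) => z zj; have [_ Di] := hD (i + i0)%N.
  have -> : D (i + i0)%N *m z = B *m z - (- ((D (i + i0)%N - B) *m z)).
    by rewrite opprK -mulmxDl addrC subrK.
  apply: le_trans (cnorm_subr hnu' _ _); rewrite (cnormN hnu') mulrBl.
  apply: lerB; first exact: Bm.
  apply: (le_trans (le1 _)); rewrite /K' /K -!mulrA ler_wpM2l ?(ltW K10)//.
  apply: (le_trans (Di _)); rewrite -!mulrA ler_wpM2l ?(ltW rho0)//.
  rewrite exprD [K2 * _]mulrCA [q ^+ i * _ * _]mulrAC -!mulrA.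
  rewrite [leRHS](_ : _ = q ^+ i0 * (q ^+ i * (K2 * nu' z))); last by ring.
  rewrite [leLHS](_ : _ = q ^+ i0 * (q ^+ i * nu z)); last by ring.
  by rewrite !ler_wpM2l ?exprn_ge0 ?(ltW q0).
have h := growth_ge m0 K'0 hi0 q01 (fun i => cnorm_ge0 hnu' _) dx (N - i0).
have {}h : E * m ^+ (N - i0) * nu' (mxprod D i0 *m y) <= nu' (mxprod D N *m y).
  by have := h; rewrite /x add0n subnK.
have mN : m ^+ N = m ^+ (N - i0) * m ^+ i0 by rewrite -exprD subnK.
have Er : 0 < rho ^+ i0 * E by rewrite mulr_gt0.
rewrite [leRHS]mulrAC ler_pdivlMr// mN.
apply: le_trans (_ : m ^+ i0 * K2 * nu' (mxprod D N *m y) <= _); last first.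
  by rewrite -!mulrA ler_wpM2l ?(ltW mi0)// mulrCA ler_wpM2l ?(ltW K20)// le1.
apply: le_trans (_ : m ^+ i0 * K2 * (E * m ^+ (N - i0) * nu' (mxprod D i0 *m y)) <= _); last first.
  by rewrite ler_wpM2l// ltW// mulr_gt0.
rewrite [leRHS](_ : _ = m ^+ (N - i0) * m ^+ i0 * E * (K2 * nu' (mxprod D i0 *m y))); last by ring.
rewrite [leLHS](_ : _ = m ^+ (N - i0) * m ^+ i0 * E * (rho ^+ i0 * nu y)); last by ring.
rewrite ler_wpM2l ?mulr_ge0 ?exprn_ge0 ?(ltW m0) ?(ltW E0)//.
exact: le_trans (step2 i0) (le2 _).
Qed.

End BlockProducts.

(** * Decay of the off-diagonal blocks *)

Section OffDiagonalDecay.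
Variables (R : realType) (ell : nat) (B G pj pk : 'M[R[i]]_ell).
Local Notation V := 'cV[R[i]]_ell.
Local Notation mx := 'M[R[i]]_ell.
Variables (nu nu' : V -> R) (eta rho q hi lo m : R).
Hypotheses (hnu : is_cnorm nu) (hnu' : is_cnorm nu').
Hypotheses (Bk : pk *m B = B *m pk) (Gj : pj *m G = G *m pj).
Hypotheses (pkk : pk *m pk = pk) (BGj : B *m G *m pj = pj).
Hypothesis pk1 : opbound nu pk 1.
Hypotheses (eta0 : 0 < eta) (rho0 : 0 < rho) (q0 : 0 < q).
Hypotheses (hi0 : 0 <= hi) (gap : hi < lo * m) (qm : q <= m).
Hypothesis nu_hi : forall x, pk *m x = x -> nu' (B *m x) <= hi * nu' x.
Hypothesis nu_lo : forall x, pj *m x = x -> lo * nu' x <= nu' (B *m x).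

(** Solving the intertwining relation for the block of [H i.+1] gives the
    recursion [a_(i+1) <= (hi * a_i + O(q^i)) / lo] for its size in [nu']; any
    [m] above both [hi / lo] and [q] bounds its growth. *)
Lemma offdiagonal_decay : exists C, 0 < C /\ forall Dl H D : nat -> mx,
  (forall i, [/\ opbound nu (Dl i) (eta * q ^+ i),
    (B + Dl i) *m H i = H i.+1 *m D i, opbound nu (D i - B) (rho * q ^+ i) &
    opbound nu (H i) 2]) ->
  forall N z, pj *m z = z -> nu (pk *m (H N *m z)) <= C * m ^+ N * nu z.
Proof.
have [K1 [K10 le1]] := cnorm_equiv hnu' hnu.
have [K2 [K20 le2]] := cnorm_equiv hnu hnu'.
have m0 : 0 < m by exact: lt_le_trans qm.
have g0 : 0 < lo * m - hi by rewrite subr_gt0.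
pose F := K1 * K2 * (2 * eta + 2 * rho).
have F0 : 0 < F by rewrite !mulr_gt0// addr_gt0// mulr_gt0.
pose K := 2 * K1 * K2 + F / (lo * m - hi).
have K0 : 0 < K by rewrite addr_gt0 ?(divr_gt0 F0 g0) ?mulr_gt0.
have FK : F <= K * (lo * m - hi).
  by rewrite -ler_pdivrMr// /K lerDr ltW// !mulr_gt0.
exists (K2 * K * K1); split; first by rewrite !mulr_gt0.
move=> Dl H D hD.
have main N x : pj *m x = x -> nu' (pk *m (H N *m x)) <= K * m ^+ N * nu' x.
  elim: N x => [|N ih] x xj.
    rewrite expr0 mulr1; apply: (le_trans (le1 _)).
    apply: le_trans (_ : K1 * (2 * nu x) <= _).
      rewrite ler_wpM2l ?(ltW K10)//; have [_ _ _ H2] := hD 0%N.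
      by apply: (le_trans (pk1 _)); rewrite mul1r.
    apply: le_trans (_ : 2 * K1 * K2 * nu' x <= _).
      by rewrite mulrCA -!mulrA !ler_wpM2l ?(ltW K10).
    by rewrite ler_wpM2r ?cnorm_ge0// lerDl ltW// divr_gt0.
  pose y := G *m x.
  have yj : pj *m y = y by rewrite /y mulmxA Gj -mulmxA xj.
  have By : B *m y = x by rewrite /y -{1}xj !mulmxA BGj.
  have [Dlm HD DB H2] := hD N; have [_ _ _ H2'] := hD N.+1.
  have -> : pk *m (H N.+1 *m x) = B *m (pk *m (H N *m y))
      + (pk *m (Dl N *m (H N *m y)) - pk *m (H N.+1 *m ((D N - B) *m y))).
    have e : pk *m (H N.+1 *m (D N *m y)) =
        B *m (pk *m (H N *m y)) + pk *m (Dl N *m (H N *m y)).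
      rewrite [H N.+1 *m _]mulmxA -HD -mulmxA mulmxDl mulmxDr; congr (_ + _).
      by rewrite !mulmxA Bk.
    by rewrite mulmxBl By !mulmxBr e addrA opprB addrCA subrr addr0.
  have qN0 : 0 <= q ^+ N by rewrite exprn_ge0// ltW.
  have nuy : nu y <= K2 * nu' y by exact: le2.
  have y0 : 0 <= nu' y by exact: cnorm_ge0.
  have t1 : nu' (B *m (pk *m (H N *m y))) <= hi * (K * m ^+ N * nu' y).
    apply: (le_trans (nu_hi _)); first by rewrite mulmxA pkk.
    by rewrite ler_wpM2l// ih.
  have t2 : nu' (pk *m (Dl N *m (H N *m y))) <= K1 * (2 * eta * q ^+ N * (K2 * nu' y)).
    apply: (le_trans (le1 _)); rewrite ler_wpM2l ?(ltW K10)//.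
    apply: (le_trans (pk1 _)); rewrite mul1r; apply: (le_trans (Dlm _)).
    apply: le_trans (_ : eta * q ^+ N * (2 * nu y) <= _).
      by rewrite ler_wpM2l// mulr_ge0// ltW.
    rewrite mulrCA !mulrA -!mulrA ler_wpM2l// ler_wpM2l ?(ltW eta0)//.
    by rewrite ler_wpM2l.
  have t3 : nu' (pk *m (H N.+1 *m ((D N - B) *m y))) <=
      K1 * (2 * rho * q ^+ N * (K2 * nu' y)).
    apply: (le_trans (le1 _)); rewrite ler_wpM2l ?(ltW K10)//.
    apply: (le_trans (pk1 _)); rewrite mul1r; apply: (le_trans (H2' _)).
    rewrite -!mulrA ler_wpM2l//; apply: (le_trans (DB _)).
    by rewrite -!mulrA ler_wpM2l ?(ltW rho0)// ler_wpM2l.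
  have t4 : nu' (B *m (pk *m (H N *m y)) + (pk *m (Dl N *m (H N *m y))
      - pk *m (H N.+1 *m ((D N - B) *m y)))) <=
      (hi * K * m ^+ N + F * q ^+ N) * nu' y.
    apply: (le_trans (cnormD hnu' _ _)).
    apply: le_trans (lerD t1 (le_trans (cnormB hnu' _ _) (lerD t2 t3))) _.
    by rewrite /F le_eqVlt; apply/orP; left; apply/eqP; ring.
  apply: (le_trans t4).
  have lx : lo * nu' y <= nu' x by rewrite -By nu_lo.
  have qm' : q ^+ N <= m ^+ N by rewrite lerXn2r// nnegrE ltW.
  have c0 : hi * K * m ^+ N + F * q ^+ N <= lo * (K * m ^+ N.+1).
    apply: le_trans (_ : hi * K * m ^+ N + K * (lo * m - hi) * m ^+ N <= _).
      by rewrite lerD2l ler_pM// ltW.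
    by rewrite exprS le_eqVlt; apply/orP; left; apply/eqP; ring.
  apply: le_trans (ler_wpM2r y0 c0) _; rewrite mulrAC mulrC ler_wpM2l//.
  by rewrite mulr_ge0 ?exprn_ge0 ?(ltW K0) ?(ltW m0).
move=> N z zj; apply: (le_trans (le2 _)).
rewrite -!mulrA ler_wpM2l ?(ltW K20)//; apply: (le_trans (main N z zj)).
rewrite -!mulrA ler_wpM2l ?(ltW K0)// [leRHS]mulrCA ler_wpM2l//.
by rewrite exprn_ge0// ltW.
Qed.

End OffDiagonalDecay.

(** * From exponential rates to subexponential relations *)

Section AsymptoticTranslation.
Variables (R : realType) (Y : Type) (S : set Y).
Implicit Types (f g : nat -> Y -> R) (a : R).

Lemma expR_eventually_ge (C e : R) : 0 < e ->
  exists N0 : nat, forall N, (N0 <= N)%N -> C <= expR (e * N%:R).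
Proof.
move=> e0; exists (Num.bound (C / e)) => N hN.
have h : C / e < N%:R.
  apply: (le_lt_trans (ler_norm _)); apply: (lt_le_trans (archi_boundP (normr_ge0 _))).
  by rewrite ler_nat; apply: leq_trans hN; rewrite /Num.bound normr_id.
rewrite ltr_pdivrMr// mulrC in h.
by apply: le_trans (expR_ge1Dx _); rewrite (le_trans (ltW h))// lerDr.
Qed.

Lemma lessapprox_of_rate_gt f g a : 0 < a -> (forall N y, 0 <= g N y) ->
  (forall m, a < m -> exists C, 0 < C /\ exists N0 : nat,
    forall N y, (N0 <= N)%N -> S y -> f N y <= C * m ^+ N * g N y) ->
  lessapprox S f (fun N y => a ^+ N * g N y).
Proof.
move=> a0 g0 hf e e0; have e20 : 0 < e / 2 by rewrite divr_gt0.
have am : a < a * expR (e / 2) by rewrite ltr_pMr// expR_gt1.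
have [C [C0 [N0 hN0]]] := hf _ am; have [N1 hN1] := expR_eventually_ge C e20.
exists (maxn N0 N1) => N y; rewrite geq_max => /andP[hN hN'] Sy.
apply: (le_trans (hN0 N y hN Sy)); rewrite [leRHS]mulrA ler_wpM2r//.
rewrite exprMn -expRM_natl mulrCA [leRHS]mulrC ler_wpM2l ?exprn_ge0 ?(ltW a0)//.
have -> : e * N%:R = e / 2 * N%:R + N%:R * (e / 2) by field.
by rewrite expRD ler_wpM2r ?expR_ge0// hN1.
Qed.

Lemma lessapprox_of_rate_lt f g a : 0 < a -> (forall N y, 0 <= f N y) ->
  (forall m, 0 < m < a -> exists C, 0 < C /\ exists N0 : nat,
    forall N y, (N0 <= N)%N -> S y -> m ^+ N * g N y <= C * f N y) ->
  lessapprox S (fun N y => a ^+ N * g N y) f.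
Proof.
move=> a0 f0 hf e e0; have e20 : 0 < e / 2 by rewrite divr_gt0.
have am : 0 < a * expR (- (e / 2)) < a.
  by rewrite mulr_gt0 ?expR_gt0//= gtr_pMr// expR_lt1 oppr_lt0.
have [C [C0 [N0 hN0]]] := hf _ am; have [N1 hN1] := expR_eventually_ge C e20.
exists (maxn N0 N1) => N y; rewrite geq_max => /andP[hN hN'] Sy.
have {}hN0 := hN0 N y hN Sy.
have -> : a ^+ N = (a * expR (- (e / 2))) ^+ N * expR (e / 2 * N%:R).
  rewrite exprMn -expRM_natl -[RHS]mulrA -expRD (_ : _ + _ = 0) ?expR0 ?mulr1//.
  by ring.
rewrite mulrAC; apply: le_trans (ler_wpM2r (expR_ge0 _) hN0) _.
rewrite mulrAC ler_wpM2r//.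
have -> : e * N%:R = e / 2 * N%:R + e / 2 * N%:R by field.
by rewrite expRD ler_wpM2r ?expR_ge0// hN1.
Qed.

Lemma superexponential_of_rate_gt0 f g : (forall N y, 0 <= g N y) ->
  (forall m, 0 < m -> exists C, 0 < C /\ exists N0 : nat,
    forall N y, (N0 <= N)%N -> S y -> f N y <= C * m ^+ N * g N y) ->
  forall K : R, exists N0 : nat,
    forall N y, (N0 <= N)%N -> S y -> f N y <= expR (- K * N%:R) * g N y.
Proof.
move=> g0 hf K; have [C [C0 [N0 hN0]]] := hf _ (expR_gt0 (- K - 1)).
have [N1 hN1] := expR_eventually_ge C ltr01.
exists (maxn N0 N1) => N y; rewrite geq_max => /andP[hN hN'] Sy.
apply: (le_trans (hN0 N y hN Sy)); rewrite ler_wpM2r// -expRM_natl.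
apply: le_trans (ler_wpM2r (expR_ge0 _) (hN1 N hN')) _.
by rewrite -expRD le_eqVlt; apply/orP; left; apply/eqP; congr expR; ring.
Qed.

End AsymptoticTranslation.

(** * The conjugacy, uniformly in the base point *)

Section UniformConjugacy.
Variables (R : realType) (ell : nat).
Local Notation mx := 'M[R[i]]_ell.

(** The inverse of [1] plus the sum of the inverses is below every [f i]. *)
Lemma finite_gap (I : finType) (f : I -> R) : (forall i, 0 < f i) ->
  exists2 c, 0 < c <= 1 & forall i, c <= f i.
Proof.
move=> f0; pose T := 1 + \sum_i (f i)^-1.
have S0 : 0 <= \sum_i (f i)^-1 by apply: sumr_ge0 => i _; rewrite invr_ge0 ltW.
have T0 : 0 < T by rewrite /T; lra.
exists T^-1; first by rewrite invr_gt0 T0 invf_le1// /T; lra.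
move=> i; rewrite -[f i]invrK lef_pV2 ?posrE ?invr_gt0// /T (bigD1 i)//= addrCA lerDl.
by rewrite addr_ge0// sumr_ge0// => k _; rewrite invr_ge0 ltW.
Qed.

Lemma rate_gap (B : mx) : exists2 c, 0 < c <= 1 &
  forall j k : 'I_(nexp B).+1, (j < k)%N -> rate B k + c <= rate B j.
Proof.
have [|c c01 hc] := @finite_gap ('I_(nexp B).+1 * 'I_(nexp B).+1)%type
  (fun p => if (p.1 < p.2)%N then rate B p.1 - rate B p.2 else 1).
  move=> [j k] /=; case: ifP => // jk.
  by rewrite subr_gt0 rate_lt// -ltnS.
by exists c => // j k jk; have := hc (j, k); rewrite /= jk; lra.
Qed.

Variables (d : nat) (lambda : R) (A : 'cV[R]_d -> mx).
Variable P : 'I_(nexp (A 0)).+1 -> mx.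
Hypotheses (hlambda : 1 < lambda) (hA : lipschitz_at0 A).
Hypothesis hP : spectral_projections P.
Local Notation n := (nexp (A 0)).

Lemma enormZ (c : R) (xi : 'cV[R]_d) : 0 <= c -> enorm (c *: xi) = c * enorm xi.
Proof.
move=> c0; rewrite /enorm -[in RHS](ger0_norm c0) -sqrtr_sqr -sqrtrM ?sqr_ge0//.
by rewrite mulr_sumr; congr Num.sqrt; apply: eq_bigr => i _; rewrite mxE exprMn.
Qed.

Let q := lambda^-1.
Let q01 : 0 < q < 1.
Proof. by rewrite invr_gt0 invf_lt1 ?(lt_trans ltr01 hlambda)//= hlambda andbT. Qed.

Lemma uniform_conjugacy :
  exists (nu : 'cV[R[i]]_ell -> R) (rho eta r : R) (G : mx)
    (H D : 'cV[R]_d -> nat -> mx),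
  [/\ is_cnorm nu /\ [/\ 0 < rho, rho <= 2^-1, 0 < eta & 0 < r],
      (forall j, opbound nu (P j) 1) /\
      (forall (j : 'I_n.+1) x, (j < n)%N -> P j *m x = x ->
        2 * rho * nu x <= nu (A 0 *m x)),
      forall (j : 'I_n.+1) x, diagonalizable (A 0) \/ mult (A 0) j = 1%N -> P j *m x = x ->
        nu (A 0 *m x) = rate (A 0) j * nu x,
      (forall j, P j *m G = G *m P j) /\
      (forall j : 'I_n.+1, (j < n)%N -> A 0 *m G *m P j = P j) &
      forall xi, eball r xi -> forall m,
      [/\ opbound nu (A (q ^+ m *: xi) - A 0) (eta * q ^+ m) /\
          A (q ^+ m *: xi) *m H xi m = H xi m.+1 *m D xi m,
          forall j, P j *m D xi m = D xi m *m P j,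
          opbound nu (D xi m - A 0) (rho * q ^+ m),
          opbound nu (H xi m - 1%:M) rho &
          forall j k : 'I_n.+1, (k < j)%N ->
            opbound nu (P k *m H xi m *m P j) (rho * q ^+ m)]].
Proof.
have [c /andP[c0 c1] hc] := rate_gap (A 0).
(* with [eps] a quarter of the gap [c], [rate B k + eps] stays below
   [rate B j - eps] by [c / 2] when [j < k] *)
pose eps := c / 4; have eps0 : 0 < eps by rewrite divr_gt0.
have [nu [hnu nu_sum nu_eps nu_ss]] := adapted_norm hP eps0.
pose lo (j : 'I_n.+1) := rate (A 0) j - eps; pose hi (j : 'I_n.+1) := rate (A 0) j + eps.
have nu_lo j x : P j *m x = x -> lo j * nu x <= nu (A 0 *m x).
  by case/nu_eps/andP.
have nu_hi j x : P j *m x = x -> nu (A 0 *m x) <= hi j * nu x.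
  by case/nu_eps/andP.
have hi0 j : 0 < hi j by rewrite ltr_wpDl// rate_ge0.
pose M := 1 + \sum_(j < n.+1) rate (A 0) j.
have rateM (j : 'I_n.+1) : rate (A 0) j <= M.
  rewrite /M (bigD1 j)//= addrCA lerDl addr_ge0// sumr_ge0// => k _.
  exact: rate_ge0.
have M1 : 1 <= M by rewrite lerDl sumr_ge0// => k _; exact: rate_ge0.
have M0 : 0 < M by rewrite (lt_le_trans ltr01).
pose kappa := 1 - c / (2 * M).
have cM : 0 < c / (2 * M) <= 2^-1.
  by rewrite divr_gt0 ?mulr_gt0//= ler_pdivrMr ?mulr_gt0//; lra.
have kappa01 : 0 <= kappa < 1.
  by case/andP: cM => h1 h2; rewrite /kappa; apply/andP; split; lra.
have gap (j k : 'I_n.+1) : (j < k)%N -> hi k <= kappa * lo j.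
  move=> jk; have h1 := hc j k jk; rewrite /kappa mulrBl mul1r.
  have : c / (2 * M) * lo j <= c / 2.
    rewrite mulrAC ler_pdivrMr ?mulr_gt0//.
    have : c * lo j <= c * M by rewrite ler_wpM2l ?(ltW c0)// /lo; have := rateM j; lra.
    by lra.
  by rewrite /hi /lo /eps; lra.
have PP := spectral_projection_mul hP; have PB := spectral_projection_comm hP.
have sumP := hP.1.2.
have [G [PG _ BGP]] := block_inverse hnu PP sumP PB nu_lo hi0 kappa01 gap.
(* [2 * rho <= c / 2] is below the smallest dilation [lo j] of an invertible
   block, so the perturbed blocks stay invertible *)
pose rho := c / 4; have rho0 : 0 < rho by rewrite divr_gt0.
have rho1 : 0 < rho <= 1 by rewrite rho0 /rho; lra.
have [eta [eta0 hdiag]] := block_diagonalization hnu PP sumP PB nu_sum nu_lo nu_hi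
  hi0 kappa01 gap rho1 q01.
have [C [delta [C0 delta0 lip]]] := hA.
have [K [K0 hK]] := opbound_le_entries hnu.
(* [K * C * r <= eta] puts [A (q ^+ m *: xi) - A 0] below the threshold *)
pose r := Num.min delta (eta / (K * C)).
have r0 : 0 < r by rewrite lt_min delta0 divr_gt0// mulr_gt0.
have /andP[q0 q1] := q01.
have Dl xi : eball r xi -> forall m, opbound nu (A (q ^+ m *: xi) - A 0) (eta * q ^+ m).
  move=> /= xir m; have qm0 : 0 <= q ^+ m by rewrite exprn_ge0// ltW.
  have xi0 : 0 <= enorm xi by exact: sqrtr_ge0.
  have en : enorm (q ^+ m *: xi) = q ^+ m * enorm xi by rewrite enormZ.
  have end_ : enorm (q ^+ m *: xi) <= delta.
    rewrite en; apply: le_trans (_ : enorm xi <= _).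
      by rewrite ler_piMl// exprn_ile1// ltW.
    by apply: (le_trans xir); rewrite ge_min lexx.
  apply: (opbound_le hnu (hK _ (C * enorm (q ^+ m *: xi)) _)).
    by move=> i j; rewrite !mxE; exact: lip.
  rewrite en mulrA mulrCA mulrC ler_wpM2r//.
  have : enorm xi <= eta / (K * C) by apply: (le_trans xir); rewrite ge_min lexx orbT.
  by rewrite ler_pdivlMr ?mulr_gt0// mulrC.
have HD xi : exists HD : (nat -> mx) * (nat -> mx), eball r xi -> forall m,
  [/\ A (q ^+ m *: xi) *m HD.1 m = HD.1 m.+1 *m HD.2 m,
      forall j, P j *m HD.2 m = HD.2 m *m P j,
      opbound nu (HD.2 m - A 0) (rho * q ^+ m), opbound nu (HD.1 m - 1%:M) rho &
      forall j k : 'I_n.+1, (k < j)%N ->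
        opbound nu (P k *m HD.1 m *m P j) (rho * q ^+ m)].
  have [xir|xir] := pselect (eball r xi); last by exists (fun=> 0, fun=> 0).
  have [H [D hHD]] := hdiag _ (Dl xi xir); exists (H, D) => _ m /=.
  by have [h1 h2 h3 h4 h5] := hHD m; split=> //; rewrite -h1 addrC subrK.
exists nu, rho, eta, r, G, (fun xi => (sval (cid (HD xi))).1),
  (fun xi => (sval (cid (HD xi))).2).
split=> //.
- by split=> //; split=> //; rewrite /rho; lra.
- split=> [j|j x jn xj]; first exact: opbound_proj.
  apply: le_trans (nu_lo _ _ xj); rewrite ler_wpM2r ?cnorm_ge0// /lo /rho /eps.
  have : rate (A 0) (@ord_max n) + c <= rate (A 0) j by exact: hc.
  by rewrite rate_last; lra.
- move=> xi xir m; have [h1 h2 h3 h4 h5] := svalP (cid (HD xi)) xir m.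
  by split=> //; split=> //; exact: Dl.
Qed.

End UniformConjugacy.

Theorem theorem5p4 (R : realType) (d ell : nat) (lambda : R)
    (A : 'cV[R]_d -> 'M[R[i]]_ell) (nrm : 'cV[R[i]]_ell -> R)
    (P : 'I_(nexp (A 0)).+1 -> 'M[R[i]]_ell)
    (hlambda : 1 < lambda) (hA : lipschitz_at0 A) (hnrm : is_cnorm nrm)
    (hP : spectral_projections P) :
  exists r : R, 0 < r /\
  exists Q : 'cV[R]_d -> 'I_(nexp (A 0)).+1 -> 'M[R[i]]_ell,
    (forall xi, eball r xi -> projection_family (Q xi)) /\
    let D : set ('cV[R]_d * 'cV[R[i]]_ell) := [set y | eball r y.1] in
    let AQ j N (y : 'cV[R]_d * 'cV[R[i]]_ell) : 'cV[R[i]]_ell :=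
      cocycle lambda A N y.1 *m (Q y.1 j *m y.2) in
    let Qx j (y : 'cV[R]_d * 'cV[R[i]]_ell) : 'cV[R[i]]_ell :=
      Q y.1 j *m y.2 in
    [/\ (* (i) *)
        forall j : 'I_(nexp (A 0)).+1, approx_rate D (chi (A 0) j)
          (fun N y => nrm (AQ j N y)) (fun _ y => nrm (Qx j y)),
        (* (ii) *)
        forall j k : 'I_(nexp (A 0)).+1,
          ((k < j)%N ->
            lesssim D (fun N y => nrm (P k *m AQ j N y))
              (fun N y => lambda ^- N * nrm (AQ j N y))) /\
          ((j < k)%N ->
            lessapprox D (fun N y => nrm (P k *m AQ j N y))
              (fun N y =>
                 (Num.max (fine (expeR (chi (A 0)%R k - chi (A 0)%R j)%E))
                    (lambda^-1)) ^+ N * nrm (AQ j N y))),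
        (* (iii) *)
        forall j : 'I_(nexp (A 0)).+1, (j < nexp (A 0)%R)%N -> mult (A 0) j = 1%N ->
          lesssim D (fun N y => exprate (chi (A 0) j) N * nrm (Qx j y))
            (fun N y => nrm (AQ j N y))
      & (* (iv) *)
        diagonalizable (A 0) ->
        forall j : 'I_(nexp (A 0)).+1, (j < nexp (A 0)%R)%N ->
          asymp D (fun N y => nrm (AQ j N y))
            (fun N y => exprate (chi (A 0) j) N * nrm (Qx j y))].
Proof.
pose B := A 0; pose n := nexp B; pose q := lambda^-1.
have q01 : 0 < q < 1.
  by rewrite invr_gt0 invf_lt1 ?(lt_trans ltr01 hlambda)//= hlambda andbT.
have /andP[q0 q1] := q01.
have [nu [rho [eta [r [G [H [D [[hnu [rho0 rho1 eta0 r0]]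
  [P1 nu_c0] nu_ss [PG BGP] conj]]]]]]]] := uniform_conjugacy hlambda hA hP.
have PP := spectral_projection_mul hP; have PB := spectral_projection_comm hP.
have sumP := hP.1.2.
have adapted e := adapted_norm hP (eps := e).
exists r; split=> //; exists (fun xi j => H xi 0%N *m P j *m invmx (H xi 0%N)).
have nu0 := cnorm_ge0 hnu; have nrm0 := cnorm_ge0 hnrm.
have H_le xi m z : eball r xi -> nu (H xi m *m z) <= 2 * nu z.
  move=> xir; have [_ _ _ h _] := conj xi xir m.
  have -> : H xi m *m z = z + (H xi m - 1%:M) *m z.
    by rewrite mulmxBl mul1mx addrC subrK.
  apply: (le_trans (cnormD hnu _ _)); have := h z.
  by have : rho * nu z <= 2^-1 * nu z by [rewrite ler_wpM2r]; have := nu0 z; lra.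
have H_ge xi m z : eball r xi -> nu z <= 2 * nu (H xi m *m z).
  move=> xir; have [_ _ _ h _] := conj xi xir m.
  have zE : z = H xi m *m z - (H xi m - 1%:M) *m z.
    by rewrite mulmxBl mul1mx opprB addrC subrK.
  have := cnormB hnu (H xi m *m z) ((H xi m - 1%:M) *m z); rewrite -zE.
  have := h z.
  by have : rho * nu z <= 2^-1 * nu z by [rewrite ler_wpM2r]; have := nu0 z; lra.
have Hu xi m : eball r xi -> H xi m \in unitmx.
  move=> xir; apply: unitmx_col_inj => x Hx; apply: (cnorm_eq0 hnu).
  by apply/eqP; rewrite eq_le nu0 andbT; have := H_ge xi m x xir; rewrite Hx (cnorm0 hnu) mulr0.
split=> [xi xir|S AQ Qx].
  have Hu0 := Hu xi 0%N xir; split=> [j|].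
    by rewrite -!mulmxA (mulKmx Hu0) [P j *m (P j *m _)]mulmxA PP eqxx.
  by rewrite -mulmx_suml -mulmx_sumr sumP mulmx1 mulmxV.
pose w j (y : 'cV[R]_d * 'cV[R[i]]_ell) := P j *m (invmx (H y.1 0%N) *m y.2).
have Pw j y : P j *m w j y = w j y by rewrite /w mulmxA PP eqxx.
pose z j N (y : 'cV[R]_d * 'cV[R[i]]_ell) := mxprod (D y.1) N *m w j y.
have QxE j y : S y -> Qx j y = H y.1 0%N *m w j y.
  by move=> _; rewrite /Qx /w !mulmxA.
have cocycleE xi N : eball r xi ->
    cocycle lambda A N xi *m H xi 0%N = H xi N *m mxprod (D xi) N.
  move=> xir; elim: N => [|N ih] /=; first by rewrite mul1mx mulmx1.
  have [[_ h] _ _ _ _] := conj xi xir N.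
  rewrite -mulmxA ih mulmxA.
  have -> : A (lambda ^- N *: xi) = A (q ^+ N *: xi) by rewrite /q exprVn.
  by rewrite h mulmxA.
have AQE j N y : S y -> AQ j N y = H y.1 N *m z j N y.
  move=> Sy; rewrite /AQ -/(Qx j y) QxE// mulmxA cocycleE//.
  by rewrite -mulmxA.
have zP j N y : S y -> P j *m z j N y = z j N y.
  move=> Sy; rewrite /z mulmxA mxprod_comm; last first.
    by move=> m; have [_ h _ _ _] := conj y.1 Sy m.
  by rewrite -mulmxA Pw.
(* [H] distorts [nu] by a factor at most [2], whence the constants
   [2 * K1] and [2 * K2] in the comparison of the two norms *)
have [K1 [K10 le1]] := cnorm_equiv hnrm hnu.
have [K2 [K20 le2]] := cnorm_equiv hnu hnrm.
have AQ_le j N y : S y -> nrm (AQ j N y) <= 2 * K1 * nu (z j N y).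
  move=> Sy; rewrite AQE//; apply: (le_trans (le1 _)).
  by rewrite [2 * K1]mulrC -[leRHS]mulrA ler_wpM2l ?(ltW K10)// H_le.
have AQ_ge j N y : S y -> nu (z j N y) <= 2 * K2 * nrm (AQ j N y).
  move=> Sy; rewrite AQE//; apply: (le_trans (H_ge y.1 N _ Sy)).
  by rewrite -mulrA ler_wpM2l.
have Qx_le j y : S y -> nrm (Qx j y) <= 2 * K1 * nu (w j y).
  move=> Sy; rewrite QxE//; apply: (le_trans (le1 _)).
  by rewrite [2 * K1]mulrC -[leRHS]mulrA ler_wpM2l ?(ltW K10)// H_le.
have Qx_ge j y : S y -> nu (w j y) <= 2 * K2 * nrm (Qx j y).
  move=> Sy; rewrite QxE//; apply: (le_trans (H_ge y.1 0%N _ Sy)).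
  by rewrite -mulrA ler_wpM2l.
have blockP j y : S y -> forall m, P j *m D y.1 m = D y.1 m *m P j /\
    opbound nu (D y.1 m - B) (rho * q ^+ m).
  by move=> Sy m; have [_ h1 h2 _ _] := conj y.1 Sy m.
have upper (j : 'I_n.+1) nu' m : is_cnorm nu' -> 0 < m ->
    (forall x, P j *m x = x -> nu' (B *m x) <= m * nu' x) ->
    exists C, 0 < C /\ forall N y, S y -> nrm (AQ j N y) <= C * m ^+ N * nrm (Qx j y).
  move=> hnu' m0 Bm.
  have [C [C0 hC]] := mxprod_le hnu rho0 q01 hnu' m0 Bm.
  exists (2 * K1 * C * (2 * K2)); split; first by rewrite !mulr_gt0.
  move=> N y Sy; apply: (le_trans (AQ_le j N y Sy)).
  rewrite -[_ * C * _]mulrA -[leRHS]mulrA -[leRHS]mulrA ler_wpM2l ?mulr_ge0 ?(ltW K10)//.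
  apply: (le_trans (hC _ _ N (blockP j y Sy) (Pw j y))).
  rewrite [leRHS](_ : _ = C * m ^+ N * (2 * K2 * nrm (Qx j y))); last by ring.
  by rewrite ler_wpM2l ?Qx_ge// mulr_ge0 ?exprn_ge0 ?(ltW C0) ?(ltW m0).
have lower (j : 'I_n.+1) nu' m : (j < n)%N -> is_cnorm nu' -> 0 < m ->
    (forall x, P j *m x = x -> m * nu' x <= nu' (B *m x)) ->
    exists C, 0 < C /\ exists N0 : nat, forall N y, (N0 <= N)%N -> S y ->
      m ^+ N * nrm (Qx j y) <= C * nrm (AQ j N y).
  move=> jn hnu' m0 Bm.
  have [C [C0 [N0 hC]]] := mxprod_ge hnu rho0 q01 hnu' m0 Bm (lexx _)
    (fun x => nu_c0 j x jn).
  exists (2 * K1 * C * (2 * K2)); split; first by rewrite !mulr_gt0.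
  exists N0 => N y hN Sy.
  apply: le_trans (_ : m ^+ N * (2 * K1 * nu (w j y)) <= _).
    by rewrite ler_wpM2l ?Qx_le// exprn_ge0// ltW.
  rewrite mulrCA -[_ * C * _]mulrA -[leRHS]mulrA ler_wpM2l ?mulr_ge0 ?(ltW K10)//.
  apply: (le_trans (hC _ _ N hN (blockP j y Sy) (Pw j y))).
  by rewrite -mulrA ler_wpM2l ?(ltW C0)// AQ_ge.
have upper_gt (j : 'I_n.+1) m : rate B j < m -> exists C, 0 < C /\
    forall N y, S y -> nrm (AQ j N y) <= C * m ^+ N * nrm (Qx j y).
  move=> jm; have e0 : 0 < m - rate B j by rewrite subr_gt0.
  have [nu' [hnu' _ nu'e _]] := adapted _ e0; apply: (upper j nu' m hnu').
    exact: le_lt_trans (rate_ge0 _ _) jm.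
  by move=> x /nu'e/andP[_]; rewrite addrC subrK.
have lower_lt (j : 'I_n.+1) m : (j < n)%N -> 0 < m < rate B j -> exists C, 0 < C /\
    exists N0 : nat, forall N y, (N0 <= N)%N -> S y ->
      m ^+ N * nrm (Qx j y) <= C * nrm (AQ j N y).
  move=> jn /andP[m0 jm]; have e0 : 0 < rate B j - m by rewrite subr_gt0.
  have [nu' [hnu' _ nu'e _]] := adapted _ e0; apply: (lower j nu' m jn hnu' m0).
  by move=> x /nu'e/andP[+ _]; rewrite opprB addrC subrK.
have chi_Ny (j : 'I_n.+1) : (chi B j == -oo%E) = (n <= j)%N.
  apply/idP/idP => [/eqP jNy|nj].
    by rewrite leqNgt; apply/negP => /chi_gtNy; rewrite jNy ltxx.
  by have -> : nat_of_ord j = n; [apply/eqP; rewrite eqn_leq nj -ltnS ltn_ord|rewrite chi_last].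
have semisimple_ge (j : 'I_n.+1) : (j < n)%N -> diagonalizable B \/ mult B j = 1%N ->
    lesssim S (fun N y => exprate (chi B j) N * nrm (Qx j y))
      (fun N y => nrm (AQ j N y)).
  move=> jn dj; have [|C [C0 [N0 hC]]] := lower j nu (rate B j) jn hnu (rate_gt0 jn).
    by move=> x /(nu_ss _ _ dj) ->.
  by exists C; split=> //; exists N0 => N y hN Sy; rewrite exprate_chi// hC.
split.
- move=> j; rewrite /approx_rate /lessapprox_rate /gtrapprox_rate chi_Ny.
  case: leqP => [nj|jn]; split=> //.
  + move=> K _; apply: superexponential_of_rate_gt0 => [N y|m m0]; first exact: nrm0.
    have [|C [C0 hC]] := upper_gt j m.
      by have -> : nat_of_ord j = n; [apply/eqP; rewrite eqn_leq nj -ltnS ltn_ord|rewrite rate_last].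
    by exists C; split=> //; exists 0%N => N y _; exact: hC.
  + have := @lessapprox_of_rate_gt _ _ S (fun N y => nrm (AQ j N y))
      (fun _ y => nrm (Qx j y)) _ (rate_gt0 jn) (fun _ _ => nrm0 _).
    move=> /(_ _) h e e0; have [|N0 hN0] := h _ e e0.
      move=> m /upper_gt[C [C0 hC]].
      by exists C; split=> //; exists 0%N => N y _; exact: hC.
    by exists N0 => N y hN Sy; rewrite exprate_chi// hN0.
  + have := @lessapprox_of_rate_lt _ _ S (fun N y => nrm (AQ j N y))
      (fun _ y => nrm (Qx j y)) _ (rate_gt0 jn) (fun _ _ => nrm0 _).
    move=> /(_ _) h e e0; have [|N0 hN0] := h _ e e0.
      by move=> m /(lower_lt j m jn).
    by exists N0 => N y hN Sy; rewrite exprate_chi// hN0.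
- move=> j k; split=> [kj|jk].
    exists (K1 * (2 * K2)); split; first by rewrite !mulr_gt0.
    exists 0%N => N y _ Sy; rewrite -exprVn -/q.
    have [_ _ _ _ h] := conj y.1 Sy N.
    apply: (le_trans (le1 _)); rewrite -!mulrA ler_wpM2l ?(ltW K10)//.
    have := h j k kj (z j N y); rewrite -!mulmxA zP// -AQE// => h1.
    apply: (le_trans h1).
    rewrite [leRHS](_ : _ = q ^+ N * (2 * K2 * nrm (AQ j N y))); last by ring.
    apply: le_trans (_ : q ^+ N * nu (z j N y) <= _); last first.
      by rewrite ler_wpM2l ?AQ_ge// exprn_ge0// ltW.
    by rewrite -mulrA ler_piMl ?mulr_ge0 ?exprn_ge0 ?(ltW q0)//; lra.
  have jn : (j < n)%N by apply: leq_trans jk _; rewrite -ltnS.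
  have rj0 := rate_gt0 jn; rewrite expeR_chiB// -/q.
  set a := Num.max _ _.
  have aq : q <= a by rewrite le_max lexx orbT.
  have ar : rate B k / rate B j <= a by rewrite le_max lexx.
  apply: lessapprox_of_rate_gt => [|N y|m am]; first exact: lt_le_trans aq.
    exact: nrm0.
  have m0 : 0 < m by exact: lt_trans (lt_le_trans q0 aq) am.
  have s0 : 0 < rate B j * m - rate B k.
    by rewrite subr_gt0 mulrC -ltr_pdivrMr// (le_lt_trans ar).
  (* moving both rates by [e] uses up half of the gap between [rate B k] and
     [rate B j * m], by [em] *)
  pose e := (rate B j * m - rate B k) / (2 * (1 + m)).
  have m1 : 0 < 2 * (1 + m) by lra.
  have e0 : 0 < e by rewrite divr_gt0.
  have ee : e * (2 * (1 + m)) = rate B j * m - rate B k by rewrite /e divfK ?gt_eqF.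
  have em : e + e * m = (rate B j * m - rate B k) / 2 by rewrite -ee; field.
  have [nu' [hnu' _ nu'e _]] := adapted _ e0.
  have hi0 : 0 <= rate B k + e by rewrite addr_ge0 ?rate_ge0 ?ltW.
  have gap : rate B k + e < (rate B j - e) * m by rewrite mulrBl; lra.
  have qm : q <= m by exact: le_trans (ltW am).
  have Pkk : P k *m P k = P k by rewrite PP eqxx.
  have [x Px|x Px|C [C0 hC]] := offdiagonal_decay hnu hnu' (PB k) (PG j) Pkk
    (BGP j jn) (P1 k) eta0 rho0 q0 hi0 gap qm.
  - by case/andP: (nu'e _ _ Px).
  - by case/andP: (nu'e _ _ Px).
  exists (K1 * C * (2 * K2)); split; first by rewrite !mulr_gt0.
  exists 0%N => N y _ Sy; rewrite AQE//; apply: (le_trans (le1 _)).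
  rewrite -!mulrA ler_wpM2l ?(ltW K10)//.
  apply: le_trans (_ : C * m ^+ N * nu (z j N y) <= _); last first.
    rewrite -!mulrA ler_wpM2l ?(ltW C0)// -AQE//.
    rewrite [leRHS](_ : _ = m ^+ N * (2 * K2 * nrm (AQ j N y))); last by ring.
    by rewrite ler_wpM2l ?AQ_ge// exprn_ge0// ltW.
  apply: (hC (fun i => A (q ^+ i *: y.1) - A 0) (H y.1) (D y.1)); last exact: zP.
  move=> i; have [[h1 h2] _ h3 h4 _] := conj y.1 Sy i; split=> //.
    by rewrite addrC subrK.
  by move=> x; exact: H_le.
- by move=> j jn dj; apply: semisimple_ge => //; right.
- move=> dB j jn; split; last by apply: semisimple_ge => //; left.
  have [x Px|C [C0 hC]] := upper j nu (rate B j) hnu (rate_gt0 jn).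
    by rewrite (nu_ss _ _ _ Px)//; left.
  exists C; split=> //; exists 0%N => N y _ Sy; rewrite exprate_chi//.
  by rewrite mulrA; exact: hC.
Qed.
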